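(* Let $tr_{\mathrm{R}}$ and $tr'_{\mathrm{R}}$ be as described in the context. Then: (1) For every sequent $\Gamma\to C$ of $\mathrm{L}^{\mathrm{R}}$: $\mathrm{L}^{\mathrm{R}}\vdash\Gamma\to C$ if and only if $\mathrm{HL}\vdash tr_{\mathrm{R}}(\Gamma\to C)$. (2) If $\mathrm{HL}\vdash G\to T$ is a derivable graph sequent all of whose types belong to $tr_{\mathrm{R}}(Tp(\mathrm{L}^{\mathrm{R}}))$, then there is an $\mathrm{L}^{\mathrm{R}}$-sequent $\Gamma\to C$ such that $G\to T\in tr'_{\mathrm{R}}(\Gamma\to C)$ and $\mathrm{L}^{\mathrm{R}}\vdash\Gamma\to C$.
   Context: $\mathrm{L}^{\mathrm{R}}$: types built from primitive types by $\backslash,/,\cdot$ and unary ${}^{\mathrm{R}}$; sequents $\Gamma\to A$ with $\Gamma$ nonempty; $(A_1,\dots,A_n)^{\mathrm{R}}=A_n^{\mathrm{R}},\dots,A_1^{\mathrm{R}}$. Axioms $p\to p$; rules of $\mathrm{L}$ ($\Pi,\Psi$ nonempty): from $\Pi\to A$, $\Gamma,B,\Delta\to C$ infer $\Gamma,\Pi,A\backslash B,\Delta\to C$; from $A,\Pi\to B$ infer $\Pi\to A\backslash B$; from $\Gamma,A,B,\Delta\to C$ infer $\Gamma,A\cdot B,\Delta\to C$; from $\Pi\to A$, $\Gamma,B,\Delta\to C$ infer $\Gamma,B/A,\Pi,\Delta\to C$; from $\Pi,A\to B$ infer $\Pi\to B/A$; from $\Pi\to A$, $\Psi\to B$ infer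 $\Pi,\Psi\to A\cdot B$; plus: from $\Gamma\to C$ infer $\Gamma^{\mathrm{R}}\to C^{\mathrm{R}}$; from $\Gamma,A^{\mathrm{RR}},\Delta\to C$ infer $\Gamma,A,\Delta\to C$; from $\Pi\to C^{\mathrm{RR}}$ infer $\Pi\to C$; cut: from $\Pi\to A$ and $\Gamma,A,\Delta\to B$ infer $\Gamma,\Pi,\Delta\to B$. Hypergraphs: given labels with arities, a graph is $G=\langle V,E,att,lab,ext\rangle$, $att:E\to V^\circledast$ (distinct nodes), $type(lab(e))=|att(e)|$, $ext\in V^\circledast$; $type(G)=|ext|$; isomorphic graphs identified. Handle $a^\bullet$: one edge labeled $a$ attached to $v_1\dots v_n$, all external. String graph $w^\bullet$ of $w=a_1\dots a_n$: nodes $v_0..v_n$, edges $e_i$, $att(e_i)=v_{i-1}v_i$, $lab(e_i)=a_i$, $ext=v_0v_n$. A generalized string graph $(a_1^{\delta_1}\dots a_n^{\delta_n})^\bullet$ ($\delta_i\in\{0,1\}$) is the same except $att(e_i)=v_{i-1}v_i$ if $\delta_i=0$ and $att(e_i)=v_iv_{i-1}$ if $\delta_i=1$. Replacement $G[e/H]$: remove $e$, insert a disjoint copy of $H$, fuse $i$-th external node of $H$ with $i$-th attachment node of $e$; relabeling $G[e:=a]$. $\mathrm{HL}$: primitive types with arities (infinitely many of each arity); symbol $\$$ of any arity. Types: primitives; $N\div D$ ($D$ has exactly one $\$$-edge $d_0$, others labeled by types, $type(N)=type(D)$, $type(N\div D)=type_D(d_0)$); $\times(M)$ ($M$ type-labeled,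 $type(\times(M))=type(M)$). Graph sequent $H\to A$, $type(H)=type(A)$. Axioms $p^\bullet\to p$. Rules: $(\div\to)$: for $N\div D$, $E_D=\{d_0,\dots,d_k\}$, $e\in E_H$ labeled $N$: from $H\to A$, $H_i\to lab(d_i)$ infer $H[e/D][d_0:=N\div D][d_1/H_1,\dots,d_k/H_k]\to A$; $(\to\div)$: from $D[d_0/F]\to N$ infer $F\to N\div D$; $(\times\to)$: $e\in E_G$ labeled $\times(F)$, from $G[e/F]\to A$ infer $G\to A$; $(\to\times)$: $E_M=\{m_1,\dots,m_l\}$, from $H_i\to lab(m_i)$ infer $M[m_1/H_1,\dots,m_l/H_l]\to\times(M)$. Translations: $tr_{\mathrm{R}}(p)=p$ (primitive of type 2), $tr_{\mathrm{R}}(A/B)=tr_{\mathrm{R}}(A)\div(\$\,tr_{\mathrm{R}}(B))^\bullet$, $tr_{\mathrm{R}}(B\backslash A)=tr_{\mathrm{R}}(A)\div(tr_{\mathrm{R}}(B)\,\$)^\bullet$, $tr_{\mathrm{R}}(A\cdot B)=\times((tr_{\mathrm{R}}(A)\,tr_{\mathrm{R}}(B))^\bullet)$, $tr_{\mathrm{R}}(A^{\mathrm{R}})=\times(M_A)$ with $M_A$ having nodes $v_1,v_2$, $ext=v_1v_2$, one edge labeled $tr_{\mathrm{R}}(A)$ with $att=v_2v_1$; $tr_{\mathrm{R}}(A_1,\dots,A_n\to A)=(tr_{\mathrm{R}}(A_1)\dots tr_{\mathrm{R}}(A_n))^\bullet\to tr_{\mathrm{R}}(A)$. Write $[A]^0=A$,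 $[A]^1=A^{\mathrm{R}}$. For a sequent $Seq=A_1,\dots,A_n\to C$, $tr'_{\mathrm{R}}(Seq)$ is the set of all graph sequents $(tr_{\mathrm{R}}(B_1)^{\delta_1}\dots tr_{\mathrm{R}}(B_n)^{\delta_n})^\bullet\to tr_{\mathrm{R}}(C)$ over all choices of $\delta_i\in\{0,1\}$ and types $B_i$ with $A_i=[B_i]^{\delta_i}$. *)

(* Defs.v *)
From mathcomp Require Import all_boot.
From Stdlib Require List Permutation.

Set Implicit Arguments.
Unset Strict Implicit.
Unset Printing Implicit Defensive.

(* A hypergraph with labels in L: nodes are 0, ..., gnv-1; each edge is a
   pair (label, attachment sequence); ext is the sequence of external
   nodes.  Edges form a list (so multi-edges are allowed); isomorphic
   graphs are identified via [giso] below. *)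
Record graph (L : Type) := Graph {
  gnv : nat;
  gedges : seq (L * seq nat);
  gext : seq nat }.
Arguments Graph {L}.

Definition nodes_ok (n : nat) (s : seq nat) : bool :=
  uniq s && all (fun v => v < n) s.

Definition graph_ok {L} (G : graph L) : Prop :=
  nodes_ok (gnv G) (gext G) /\
  forall e, List.In e (gedges G) -> nodes_ok (gnv G) e.2.

Definition giso {L} (G G' : graph L) : Prop :=
  gnv G = gnv G' /\
  exists f : nat -> nat,
    (forall v, v < gnv G -> f v < gnv G') /\
    (forall u v, u < gnv G -> v < gnv G -> f u = f v -> u = v) /\
    Permutation.Permutation
      [seq (e.1, map f e.2) | e <- gedges G] (gedges G') /\
    gext G' = map f (gext G).

Definition handle {L} (a : L) (n : nat) : graph L :=
  Graph n [:: (a, iota 0 n)] (iota 0 n).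

(* generalized string graph (a_1^{d_1} ... a_n^{d_n})^bullet
   (edge i attached to v_{i-1} v_i if d_i = false, to v_i v_{i-1} if true) *)
Definition gstr {L} (w : seq (L * bool)) : graph L :=
  Graph (size w).+1
    [seq (ab.2.1, if ab.2.2 then [:: ab.1.+1; ab.1] else [:: ab.1; ab.1.+1])
       | ab <- zip (iota 0 (size w)) w]
    [:: 0; size w].

Definition strgraph {L} (w : seq L) : graph L :=
  gstr [seq (a, false) | a <- w].

(* Simultaneous replacement: every edge i (label a, attachment att) of G
   is replaced by the graph (rep i a (size att)), whose j-th external node
   is fused with the j-th attachment node of the edge; internal nodes of
   the inserted graphs are renumbered freshly. *)
Definition n_internal {B} (R : graph B) : nat :=
  count (fun v => v \notin gext R) (iota 0 (gnv R)).

Fixpoint glue {B} (o : nat) (l : seq (seq nat * graph B))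
  : nat * seq (B * seq nat) :=
  match l with
  | [::] => (o, [::])
  | (att, R) :: l' =>
      let f v := if v \in gext R then nth 0 att (index v (gext R))
                 else o + count (fun u => u \notin gext R) (iota 0 v) in
      let r := glue (o + n_internal R) l' in
      (r.1, [seq (e.1, map f e.2) | e <- gedges R] ++ r.2)
  end.

Definition gsubst {A B} (G : graph A) (rep : nat -> A -> nat -> graph B)
  : graph B :=
  let Rs := [seq (ie.2.2, rep ie.1 ie.2.1 (size ie.2.2))
               | ie <- zip (iota 0 (size (gedges G))) (gedges G)] in
  let r := glue (gnv G) Rs in
  Graph r.1 r.2 (gext G).

Definition repl {L} (G : graph L) (e : nat) (H : graph L) : graph L :=
  gsubst G (fun i a k => if i == e then H else handle a k).

(* Prim name arity : primitive type (infinitely many of each arity);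
   Div N D : N ÷ D, where in D the label None stands for $;
   Times M : ×(M). *)
Inductive htype : Type :=
| Prim : nat -> nat -> htype
| Div : htype -> graph (option htype) -> htype
| Times : graph htype -> htype.

Definition is_dollar (e : option htype * seq nat) : bool :=
  if e.1 is None then true else false.

Definition htype_arity (A : htype) : nat :=
  match A with
  | Prim _ n => n
  | Div _ D =>
      match [seq e <- gedges D | is_dollar e] with
      | e :: _ => size e.2
      | [::] => 0
      end
  | Times M => size (gext M)
  end.

Inductive wf_type : htype -> Prop :=
| wf_prim p n : wf_type (Prim p n)
| wf_div N D :
    wf_type N ->
    graph_ok D ->
    count is_dollar (gedges D) = 1 ->
    (forall t att, List.In (Some t, att) (gedges D) ->
       wf_type t /\ htype_arity t = size att) ->
    htype_arity N = size (gext D) ->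
    wf_type (Div N D)
| wf_times M :
    graph_ok M ->
    (forall t att, List.In (t, att) (gedges M) ->
       wf_type t /\ htype_arity t = size att) ->
    wf_type (Times M).

Definition wf_seq (H : graph htype) (A : htype) : Prop :=
  graph_ok H /\
  (forall t att, List.In (t, att) (gedges H) ->
     wf_type t /\ htype_arity t = size att) /\
  wf_type A /\
  size (gext H) = htype_arity A.

Inductive hl_der : graph htype -> htype -> Prop :=
| hl_ax p n : hl_der (handle (Prim p n) n) (Prim p n)
| hl_iso H H' A : hl_der H A -> giso H H' -> hl_der H' A
| hl_divL N D H A e att (Hs : nat -> graph htype) :
    List.nth_error (gedges H) e = Some (N, att) ->
    hl_der H A ->
    (forall j t att', List.nth_error (gedges D) j = Some (Some t, att') ->
       hl_der (Hs j) t) ->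
    wf_type (Div N D) ->
    let D' := gsubst D (fun j l k => match l with
                                     | None => handle (Div N D) k
                                     | Some _ => Hs j
                                     end) in
    wf_seq (repl H e D') A ->
    hl_der (repl H e D') A
| hl_divR N D F :
    hl_der (gsubst D (fun _ l k => match l with
                                   | None => F
                                   | Some t => handle t k
                                   end)) N ->
    wf_seq F (Div N D) ->
    hl_der F (Div N D)
| hl_timesL G e F att A :
    List.nth_error (gedges G) e = Some (Times F, att) ->
    hl_der (repl G e F) A ->
    wf_seq G A ->
    hl_der G A
| hl_timesR M (Hs : nat -> graph htype) :
    (forall j t att, List.nth_error (gedges M) j = Some (t, att) ->
       hl_der (Hs j) t) ->
    wf_seq (gsubst M (fun j _ _ => Hs j)) (Times M) ->
    hl_der (gsubst M (fun j _ _ => Hs j)) (Times M).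

(* LP p : primitive; LDivL B A : B \ A; LDivR A B : A / B;
   LProd A B : A · B; LRev A : A^R *)
Inductive ltp : Type :=
| LP : nat -> ltp
| LDivL : ltp -> ltp -> ltp
| LDivR : ltp -> ltp -> ltp
| LProd : ltp -> ltp -> ltp
| LRev : ltp -> ltp.

Definition seqR (G : seq ltp) : seq ltp := map LRev (rev G).

Inductive lr_der : seq ltp -> ltp -> Prop :=
| lr_ax p : lr_der [:: LP p] (LP p)
| lr_divLL Pi A G B D C :
    Pi <> [::] -> lr_der Pi A -> lr_der (G ++ B :: D) C ->
    lr_der (G ++ Pi ++ LDivL A B :: D) C
| lr_divLR A Pi B :
    Pi <> [::] -> lr_der (A :: Pi) B -> lr_der Pi (LDivL A B)
| lr_prodL G A B D C :
    lr_der (G ++ A :: B :: D) C -> lr_der (G ++ LProd A B :: D) C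
| lr_divRL Pi A G B D C :
    Pi <> [::] -> lr_der Pi A -> lr_der (G ++ B :: D) C ->
    lr_der (G ++ LDivR B A :: Pi ++ D) C
| lr_divRR Pi A B :
    Pi <> [::] -> lr_der (Pi ++ [:: A]) B -> lr_der Pi (LDivR B A)
| lr_prodR Pi Psi A B :
    Pi <> [::] -> Psi <> [::] -> lr_der Pi A -> lr_der Psi B ->
    lr_der (Pi ++ Psi) (LProd A B)
| lr_rev G C : lr_der G C -> lr_der (seqR G) (LRev C)
| lr_rrL G A D C :
    lr_der (G ++ LRev (LRev A) :: D) C -> lr_der (G ++ A :: D) C
| lr_rrR Pi C : lr_der Pi (LRev (LRev C)) -> lr_der Pi C
| lr_cut Pi A G D B :
    lr_der Pi A -> lr_der (G ++ A :: D) B -> lr_der (G ++ Pi ++ D) B.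

Fixpoint trR (A : ltp) : htype :=
  match A with
  | LP p => Prim p 2
  | LDivR A B => Div (trR A) (strgraph [:: None; Some (trR B)])
  | LDivL B A => Div (trR A) (strgraph [:: Some (trR B); None])
  | LProd A B => Times (strgraph [:: trR A; trR B])
  | LRev A => Times (Graph 2 [:: (trR A, [:: 1; 0])] [:: 0; 1])
  end.

Definition trR_seq (G : seq ltp) (C : ltp) : graph htype * htype :=
  (strgraph (map trR G), trR C).

Definition bracketR (B : ltp) (d : bool) : ltp := if d then LRev B else B.

Definition in_trR' (H : graph htype) (T : htype) (G : seq ltp) (C : ltp)
  : Prop :=
  T = trR C /\
  exists bs : seq (ltp * bool),
    [seq bracketR bd.1 bd.2 | bd <- bs] = G /\
    giso (gstr [seq (trR bd.1, bd.2) | bd <- bs]) H.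

(* Main.v *)
Require Import Defs.
From mathcomp Require Import all_boot zify.
From Stdlib Require List Permutation.

(* HL derivations over translated types only ever involve generalized string
   graphs, and on those graphs the HL rules act as string rules in which a
   word over [(type, direction)] may be reversed together with all its
   directions ([flip]).  From HL to L^R one checks that each rule preserves
   being a string graph and is simulated by L^R; for the product rule the node
   created inside the string has exactly two incident edges, hence they are
   consecutive.  From L^R to HL, where cut has to be eliminated, types are
   interpreted as closed sets of words in the manner of Okada's semantic proof
   of cut elimination: L^R with cut is sound for this interpretation, and every
   member of the interpretation of [A] is a word from which HL derives [A]. *)

Set Implicit Arguments.
Unset Strict Implicit.
Unset Printing Implicit Defensive.

(** HL as defined here has no cut, while L^R has cut together with two rules that remove double
    reversals, so a translation of L^R derivations rule by rule stops at cut. In the interpretation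
    a reversed type denotes the flipped words; hence [A] and its double reversal denote the same
    set, the double-reversal rules become trivial, and cut is mere substitution. In the other
    direction cut is an asset: a division step of HL on an edge that runs backwards is simulated by
    cutting with a mirrored derivation. Reading words off graphs must moreover be unambiguous, since
    an HL derivation only yields some derivable word, which has to be identified with the given
    antecedent. *)

Local Notation Perm := Permutation.Permutation.
Local Notation Perm_sym := Permutation.Permutation_sym.
Local Notation Perm_trans := Permutation.Permutation_trans.

(** * Permutations, positions and membership in lists *)

Lemma Perm_filter {T} (p : pred T) (s t : seq T) :
  Perm s t -> Perm (filter p s) (filter p t).
Proof.
elim=> //= [x s1 t1 _ IH|x y s1|s1 s2 s3 _ IH1 _ IH2].
- by case: (p x) => //; apply: Permutation.perm_skip.
- by case: (p x); case: (p y) => //; apply: Permutation.perm_swap.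
- exact: Perm_trans IH1 IH2.
Qed.

Lemma Perm_map {T U} (f : T -> U) (s t : seq T) :
  Perm s t -> Perm (map f s) (map f t).
Proof. exact: Permutation.Permutation_map. Qed.

Lemma Perm_cat {T} (s1 s2 t1 t2 : seq T) :
  Perm s1 t1 -> Perm s2 t2 -> Perm (s1 ++ s2) (t1 ++ t2).
Proof. exact: Permutation.Permutation_app. Qed.

Lemma Perm_catC {T} (s t : seq T) : Perm (s ++ t) (t ++ s).
Proof. exact: Permutation.Permutation_app_comm. Qed.

Lemma Perm_catCA {T} (s t u : seq T) : Perm (s ++ t ++ u) (t ++ s ++ u).
Proof. exact: Permutation.Permutation_app_swap_app. Qed.

Lemma Perm_rev {T} (s : seq T) : Perm (rev s) s.
Proof.
elim: s => //= x s IH; rewrite rev_cons -cats1.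
apply: Perm_trans (Perm_catC _ _) _; exact: Permutation.perm_skip.
Qed.

Lemma Perm_cat_cons_inv {T} (s1 s2 t1 t2 : seq T) x :
  Perm (s1 ++ x :: s2) (t1 ++ x :: t2) -> Perm (s1 ++ s2) (t1 ++ t2).
Proof. exact: Permutation.Permutation_app_inv. Qed.

Lemma nth_error_split {T} (s : seq T) n x :
  List.nth_error s n = Some x ->
  exists s1 s2, s = s1 ++ x :: s2 /\ size s1 = n.
Proof.
by move=> h; case: (List.nth_error_split s n h) => s1 [s2 ?]; exists s1, s2.
Qed.

Lemma nth_error_mid {T} (s1 s2 : seq T) x :
  List.nth_error (s1 ++ x :: s2) (size s1) = Some x.
Proof. by elim: s1. Qed.

(** Labels range over an arbitrary type without decidable equality, so edges are handled with
    [List.In] and [Permutation]; nodes are numbers and use [\in] and [perm_eq]. *)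
Lemma In_cat {T} (x : T) s t :
  List.In x (s ++ t) <-> List.In x s \/ List.In x t.
Proof. exact: List.in_app_iff. Qed.

Lemma In_map {T U} (f : T -> U) s y :
  List.In y (map f s) <-> exists x, f x = y /\ List.In x s.
Proof. exact: List.in_map_iff. Qed.

Lemma In_nth_error {T} (s : seq T) n x :
  List.nth_error s n = Some x -> List.In x s.
Proof. exact: List.nth_error_In. Qed.

Lemma eq_map_In {T U} (f g : T -> U) s :
  (forall x, List.In x s -> f x = g x) -> map f s = map g s.
Proof. exact: List.map_ext_in. Qed.

(** * Graphs and replacement *)

Arguments glue : simpl never.

Definition emap {L} (f : nat -> nat) (e : L * seq nat) := (e.1, map f e.2).

Definition graft {L} (o : nat) (att : seq nat) (R : graph L) (v : nat) : nat :=
  if v \in gext R then nth 0 att (index v (gext R))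
  else o + count (fun u => u \notin gext R) (iota 0 v).

Lemma glue_cons {L} o att (R : graph L) l :
  glue o ((att, R) :: l) =
  ((glue (o + n_internal R) l).1,
   map (emap (graft o att R)) (gedges R) ++ (glue (o + n_internal R) l).2).
Proof. by []. Qed.

Lemma glue_cat {L} o (l1 l2 : seq (seq nat * graph L)) :
  glue o (l1 ++ l2) =
  ((glue (glue o l1).1 l2).1, (glue o l1).2 ++ (glue (glue o l1).1 l2).2).
Proof.
elim: l1 o => [|[att R] l1 IH] o; first by case: (glue o l2).
by rewrite cat_cons !glue_cons IH /= catA.
Qed.

Lemma n_internal_handle {L} (a : L) k : n_internal (handle a k) = 0.
Proof.
rewrite /n_internal /= (@eq_in_count _ _ pred0) ?count_pred0 //.
by move=> v /= ->.
Qed.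

Lemma graft_handle {L} o att (a : L) :
  map (emap (graft o att (handle a (size att)))) (gedges (handle a (size att)))
  = [:: (a, att)].
Proof.
rewrite /= /emap /=; congr [:: (_, _)].
rewrite -[RHS](mkseq_nth 0) /mkseq; apply/eq_in_map => v vI.
rewrite /graft /= vI; congr nth.
rewrite mem_iota /= in vI.
by rewrite -{1}(add0n v) -(nth_iota 0 0 vI) index_uniq ?iota_uniq ?size_iota.
Qed.

(** A handle has no internal node and its external nodes are fused with the attachment of the edge
    it replaces, so nothing changes. This is why [repl] acts on a single edge. *)
Lemma glue_handles {L} (rep : nat -> L -> nat -> graph L) o i
    (s : seq (L * seq nat)) :
  (forall j a k, i <= j < i + size s -> rep j a k = handle a k) ->
  glue o [seq (ie.2.2, rep ie.1 ie.2.1 (size ie.2.2))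
             | ie <- zip (iota i (size s)) s] = (o, s).
Proof.
elim: s i o => //= -[a att] s IH i o hrep.
have -> : rep i a (size att) = handle a (size att).
  by apply: hrep; lia.
rewrite glue_cons n_internal_handle addn0 IH; last first.
  by move=> j b k hj; apply: hrep; lia.
by rewrite graft_handle.
Qed.

Lemma replE {L} (G R : graph L) E1 a att E2 :
  gedges G = E1 ++ (a, att) :: E2 ->
  repl G (size E1) R =
  Graph (gnv G + n_internal R)
    (E1 ++ map (emap (graft (gnv G) att R)) (gedges R) ++ E2) (gext G).
Proof.
move=> hG; rewrite /repl /gsubst hG size_cat iotaD add0n zip_cat ?size_iota //.
pose rep i b k := if i == size E1 then R else @handle L b k.
rewrite map_cat glue_cat (@glue_handles _ rep (gnv G) 0); last first.
  by move=> j b k hj; rewrite /rep; case: eqP hj => // ->; lia.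
rewrite /= eqxx (@glue_handles _ rep) //.
by move=> j b k hj; rewrite /rep; case: eqP hj => // ->; lia.
Qed.

Lemma gsubst1E {A B} n (a : A) att ext (rep : nat -> A -> nat -> graph B)
    (R := rep 0 a (size att)) :
  gsubst (Graph n [:: (a, att)] ext) rep =
  Graph (n + n_internal R)
    (map (emap (graft n att R)) (gedges R)) ext.
Proof. by rewrite /gsubst /= cats0. Qed.

Lemma gsubst2E {A B} (a b : A) (rep : nat -> A -> nat -> graph B)
    (R := rep 0 a 2) (R' := rep 1 b 2) :
  gsubst (strgraph [:: a; b]) rep =
  Graph (3 + n_internal R + n_internal R')
    (map (emap (graft 3 [:: 0; 1] R)) (gedges R) ++
     map (emap (graft (3 + n_internal R) [:: 1; 2] R')) (gedges R'))
    [:: 0; 2].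
Proof. by rewrite /gsubst /= cats0. Qed.

(** The nodes satisfying [p] are numbered by their rank, so the fresh numbers of internal nodes fill
    an interval. *)
Lemma map_count_iota p o m :
  [seq o + count p (iota 0 v) | v <- iota 0 m & p v] =
  iota o (count p (iota 0 m)).
Proof.
elim: m => // m IH; rewrite -addn1 iotaD filter_cat map_cat count_cat iotaD.
by rewrite IH /= add0n; case: (p m); rewrite /= ?addn0.
Qed.

Lemma graft_ext {L} o att (R : graph L) :
  uniq (gext R) -> size att = size (gext R) ->
  map (graft o att R) (gext R) = att.
Proof.
move=> uR sz; apply: (@eq_from_nth _ 0); first by rewrite size_map.
move=> i; rewrite size_map => hi; rewrite (nth_map 0) // /graft mem_nth //.
by rewrite index_uniq.
Qed.

(** External nodes land on [att] and internal ones on a fresh interval. This gives both the node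
    list after a replacement and the injectivity behind [graft_inv]. *)
Lemma graft_perm {L} o att (R : graph L) :
  nodes_ok (gnv R) (gext R) -> size att = size (gext R) ->
  perm_eq (map (graft o att R) (iota 0 (gnv R)))
          (att ++ iota o (n_internal R)).
Proof.
move=> /andP[uR /allP hR] sz; set p := fun u => u \notin gext R.
have hp : perm_eq (iota 0 (gnv R)) (gext R ++ filter p (iota 0 (gnv R))).
  rewrite -(perm_filterC p) perm_catC perm_cat2r.
  apply: uniq_perm; rewrite ?filter_uniq ?iota_uniq // => v.
  rewrite mem_filter mem_iota /= /p negbK.
  by apply/andP/idP => [[]//|vR]; split => //; apply: hR.
apply: perm_trans (perm_map _ hp) _; rewrite map_cat graft_ext // perm_cat2l.
have -> : map (graft o att R) (filter p (iota 0 (gnv R))) =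
    [seq o + count p (iota 0 v) | v <- filter p (iota 0 (gnv R))].
  by apply/eq_in_map => v; rewrite mem_filter /graft /p => /andP[/negbTE->].
by rewrite map_count_iota.
Qed.

(** The inverse is the position in the list of images, which is duplicate-free by [graft_perm]. *)
Lemma graft_inv {L} o att (R : graph L) :
  nodes_ok (gnv R) (gext R) -> size att = size (gext R) ->
  uniq (att ++ iota o (n_internal R)) ->
  exists g, forall v, v < gnv R -> g (graft o att R v) = v.
Proof.
move=> hR sz u; set s := map (graft o att R) (iota 0 (gnv R)).
exists (fun y => index y s) => v hv.
have <- : nth 0 s v = graft o att R v by rewrite (nth_map 0) ?size_iota ?nth_iota.
by rewrite index_uniq ?size_map ?size_iota // (perm_uniq (graft_perm _ hR sz)).
Qed.

(** * Paths and string graphs *)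

Definition pedge {L} (x y : nat) (a : L * bool) : L * seq nat :=
  (a.1, if a.2 then [:: y; x] else [:: x; y]).

(** The node list is arbitrary rather than an interval, so that an isomorphism only changes [ns].
    Mismatched lengths are truncated; lemmas that need the full path assume
    [size ns = (size w).+1]. *)
Fixpoint pedges {L} (ns : seq nat) (w : seq (L * bool)) : seq (L * seq nat) :=
  match w, ns with
  | a :: w', x :: (y :: _) as ns' => pedge x y a :: pedges ns' w'
  | _, _ => [::]
  end.

Arguments pedges : simpl never.

Lemma pedges_cons {L} x y ns a (w : seq (L * bool)) :
  pedges (x :: y :: ns) (a :: w) = pedge x y a :: pedges (y :: ns) w.
Proof. by []. Qed.

Definition flip {L} (w : seq (L * bool)) := rev [seq (a.1, ~~ a.2) | a <- w].
Definition flipd {L} (d : bool) (w : seq (L * bool)) :=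
  if d then flip w else w.

Lemma flipK {L} : involutive (@flip L).
Proof.
move=> w; rewrite /flip map_rev revK -map_comp -[RHS]map_id.
by apply: eq_map => -[a d] /=; rewrite negbK.
Qed.

Lemma flip_cat {L} (u v : seq (L * bool)) : flip (u ++ v) = flip v ++ flip u.
Proof. by rewrite /flip map_cat rev_cat. Qed.

Lemma size_flip {L} (w : seq (L * bool)) : size (flip w) = size w.
Proof. by rewrite size_rev size_map. Qed.

Lemma size_flipd {L} d (w : seq (L * bool)) : size (flipd d w) = size w.
Proof. by case: d; rewrite //= size_flip. Qed.

Lemma flipd_flip {L} d (w : seq (L * bool)) : flipd d (flip w) = flipd (~~ d) w.
Proof. by case: d; rewrite //= flipK. Qed.

(** The node [p] at the cut ends the first path and starts the second, hence its double occurrence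
    on the right. *)
Lemma pedges_cat {L} L1 p L2 (w1 w2 : seq (L * bool)) :
  size w1 = size L1 ->
  pedges (L1 ++ p :: L2) (w1 ++ w2) =
  pedges (rcons L1 p) w1 ++ pedges (p :: L2) w2.
Proof.
elim: L1 w1 => [|x L1 IH] [|a w1] //= [hs].
by case: L1 IH hs => [|y L1] IH hs /=; rewrite !pedges_cons /= -IH.
Qed.

Lemma pedges_rev {L} ns (w : seq (L * bool)) :
  size ns = (size w).+1 -> pedges (rev ns) (flip w) = rev (pedges ns w).
Proof.
elim: w ns => [|[a d] w IH] [|x [|y ns]] // [hs].
have -> : rev [:: x, y & ns] = rev ns ++ y :: [:: x].
  by rewrite !rev_cons -!cats1 -catA.
rewrite -[(a, d) :: w]cat1s flip_cat pedges_cat;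
  last by rewrite size_flip size_rev; case: hs.
rewrite -rev_cons IH; last by rewrite /= hs.
rewrite -[pedges _ (_ :: w)]/(pedge x y (a, d) :: pedges (y :: ns) w).
by rewrite rev_cons -cats1; congr (_ ++ _); case: d.
Qed.

Lemma Perm_pedges_rev {L} ns (w : seq (L * bool)) :
  size ns = (size w).+1 -> Perm (pedges (rev ns) (flip w)) (pedges ns w).
Proof. by move=> /pedges_rev->; apply: Perm_rev. Qed.

Lemma pedges_map {L} f ns (w : seq (L * bool)) :
  pedges (map f ns) w = map (emap f) (pedges ns w).
Proof.
elim: w ns => [|[a d] w IH] [|x [|y ns]] //.
by rewrite pedges_cons !map_cons pedges_cons -map_cons IH /emap /pedge /=;
  case: d.
Qed.

Lemma pedges_In {L} ns (w : seq (L * bool)) e :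
  List.In e (pedges ns w) ->
  exists w1 a w2 L1 x y L2, [/\ w = w1 ++ a :: w2, size w1 = size L1,
     ns = L1 ++ x :: y :: L2 & e = pedge x y a].
Proof.
elim: w ns => [|a w IH] [|x [|y ns]] //; rewrite pedges_cons => -[<-|/IH].
  by exists [::], a, w, [::], x, y, ns.
case=> [w1 [b [w2 [L1 [x' [y' [L2 [-> hs -> ->]]]]]]]].
by exists (a :: w1), b, w2, (x :: L1), x', y', L2; split; rewrite //= hs.
Qed.

Lemma pedges_split {L} w1 (a : L * bool) w2 L1 x y L2 :
  size w1 = size L1 ->
  pedges (L1 ++ x :: y :: L2) (w1 ++ a :: w2) =
  pedges (rcons L1 x) w1 ++ pedge x y a :: pedges (y :: L2) w2.
Proof. exact: pedges_cat. Qed.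

Lemma pedges_labels {L} ns (w : seq (L * bool)) :
  size ns = (size w).+1 -> map fst (pedges ns w) = map fst w.
Proof.
elim: w ns => [|a w IH] [|x [|y ns]] // [hs].
by rewrite pedges_cons /= IH //= hs.
Qed.

Lemma pedges_sub {L} ns (w : seq (L * bool)) e :
  List.In e (pedges ns w) -> {subset e.2 <= ns}.
Proof.
move=> /pedges_In[w1 [[a d] [w2 [L1 [x [y [L2 [_ _ -> ->]]]]]]]] v /=.
by rewrite mem_cat !inE; case: d; rewrite !inE => /orP[]->; rewrite ?orbT.
Qed.

(* The path presentation of "[G] is isomorphic to [gstr w]"; it excludes
   the empty string, whose graph has a repeated external node. *)
Definition is_string {L} (G : graph L) (w : seq (L * bool)) : Prop :=
  exists ns, [/\ w <> [::], size ns = (size w).+1,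
    perm_eq ns (iota 0 (gnv G)), Perm (pedges ns w) (gedges G) &
    gext G = [:: head 0 ns; last 0 ns]].

Lemma nodes_ok_perm ns n s :
  perm_eq ns (iota 0 n) -> uniq s -> {subset s <= ns} -> nodes_ok n s.
Proof.
move=> hp us hs; rewrite /nodes_ok us; apply/allP => v /hs.
by rewrite (perm_mem hp) mem_iota.
Qed.

Lemma is_string_ok {L} (G : graph L) w :
  is_string G w ->
  [/\ graph_ok G, size (gext G) = 2 &
      forall e, List.In e (gedges G) -> size e.2 = 2].
Proof.
case=> ns [w0 hs hp he hx].
have u : uniq ns by rewrite (perm_uniq hp) iota_uniq.
split.
- split=> [|e hI].
    rewrite hx; apply: (nodes_ok_perm hp).
      case: ns hs u {hp he hx} => [|x [|y ns]] //=; first by case: w w0.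
      by move=> _ /andP[xn _]; rewrite inE andbT; apply: contra xn => /eqP->;
        apply: mem_last.
    move=> v; rewrite !inE; case: ns hs {u hp he hx} => //= x ns _.
    by case/orP => /eqP->; rewrite ?mem_head ?mem_last.
  have {}hI := Permutation.Permutation_in _ (Perm_sym he) hI.
  apply: (nodes_ok_perm hp _ (pedges_sub hI)).
  case/pedges_In: hI => w1 [[a d] [w2 [L1 [x [y [L2 [_ _ E ->]]]]]]].
  move: u;
    rewrite E cat_uniq /= !inE !negb_or => /and3P[_ _ /andP[/andP[xy _] _]].
  by case: d; rewrite /= !inE !andbT // eq_sym.
- by rewrite hx.
- move=> e hI.
  have {}hI := Permutation.Permutation_in _ (Perm_sym he) hI.
  case/pedges_In: hI => w1 [[a d] [w2 [L1 [x [y [L2 [_ _ E ->]]]]]]].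
  by case: d.
Qed.

Lemma is_string_labels {L} (G : graph L) w :
  is_string G w -> Perm (map fst w) (map fst (gedges G)).
Proof.
by case=> ns [_ hs _ he _]; rewrite -(pedges_labels hs); apply: Perm_map.
Qed.

Lemma is_string_giso {L} (G H : graph L) w :
  is_string G w -> giso G H -> is_string H w.
Proof.
case=> ns [w0 hs hp he hx] [hn [f [f1 [f2 [f3 f4]]]]].
exists (map f ns); split=> //; first by rewrite size_map.
- apply: perm_trans (perm_map f hp) _.
  have u : uniq (map f (iota 0 (gnv G))).
    rewrite map_inj_in_uniq ?iota_uniq // => x y.
    by rewrite !mem_iota /= add0n; apply: f2.
  (* [giso] only gives an injection on nodes; equal node counts make it onto. *)
  have sub : {subset map f (iota 0 (gnv G)) <= iota 0 (gnv H)}.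
    by move=> v /mapP[x]; rewrite !mem_iota /= add0n => /f1 ? ->.
  apply: uniq_perm; rewrite ?iota_uniq //.
  by case: (uniq_min_size u sub) => //; rewrite size_map !size_iota hn.
- rewrite pedges_map; exact: Perm_trans (Perm_map _ he) f3.
- by rewrite f4 hx; case: ns hs {hp he hx} => //= x ns _; rewrite last_map.
Qed.

(** The isomorphism sends the [i]-th node of one path to the [i]-th node of the other. *)
Lemma string_giso {L} (G H : graph L) w :
  is_string G w -> is_string H w -> giso G H.
Proof.
case=> ns [w0 hs hp he hx] [ms [_ hs' hp' he' hx']].
have hN : gnv G = gnv H.
  rewrite -(size_iota 0 (gnv G)) -(size_iota 0 (gnv H)).
  by rewrite -(perm_size hp) -(perm_size hp') hs hs'.
have u : uniq ns by rewrite (perm_uniq hp) iota_uniq.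
have u' : uniq ms by rewrite (perm_uniq hp') iota_uniq.
have hG v : v < gnv G -> v \in ns by rewrite (perm_mem hp) mem_iota.
have hm : map (fun v => nth 0 ms (index v ns)) ns = ms.
  apply: (@eq_from_nth _ 0); rewrite size_map ?hs ?hs' // => i hi.
  by rewrite (nth_map 0) ?hs // index_uniq ?hs.
split=> //; exists (fun v => nth 0 ms (index v ns)); split; [|split; [|split]].
- move=> v /hG hv;
    suff : nth 0 ms (index v ns) \in iota 0 (gnv H) by rewrite mem_iota.
  by rewrite -(perm_mem hp') mem_nth // hs' -hs index_mem.
- move=> x y /hG hx1 /hG hy1 /eqP; rewrite nth_uniq ?hs' -?hs ?index_mem //.
  by move=> /eqP E; rewrite -(nth_index 0 hx1) E nth_index.
- apply: Perm_trans he'; rewrite -{2}hm pedges_map; apply: Perm_map.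
  exact: Perm_sym.
- rewrite hx hx' /= -{1 2}hm.
  by case: (ns) hs => //= x ns' _;
    rewrite (last_map (fun v => nth 0 ms (index v (x :: ns')))).
Qed.

Lemma gstrE {L} (w : seq (L * bool)) :
  gstr w = Graph (size w).+1 (pedges (iota 0 (size w).+1) w) [:: 0; size w].
Proof.
rewrite /gstr; congr Graph; elim: w 0 => //= -[a d] w IH m.
by rewrite IH.
Qed.

Lemma gstr_string {L} (w : seq (L * bool)) : w <> [::] -> is_string (gstr w) w.
Proof.
move=> w0; rewrite gstrE; exists (iota 0 (size w).+1); split=> //=.
  by rewrite size_iota.
by rewrite -[last 0 _]/(last 0 (iota 0 (size w).+1)) -nth_last size_iota nth_iota.
Qed.

(** * Replacement inside string graphs *)

Lemma Perm_pedges_flip {L} x y I (w : seq (L * bool)) :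
  (size I).+1 = size w ->
  Perm (pedges (x :: rcons (rev I) y) (flip w)) (pedges (y :: rcons I x) w).
Proof.
move=> h; have -> : x :: rcons (rev I) y = rev (y :: rcons I x).
  by rewrite rev_cons rev_rcons.
by apply: Perm_pedges_rev; rewrite /= size_rcons h.
Qed.

(** The attachment nodes [x] and [y] become the ends of the inserted path; [I] lists its interior
    nodes, which are exactly the fresh ones. *)
Lemma string_graft {L} o x y (R : graph L) u :
  is_string R u ->
  exists I : seq nat,
  [/\ (size I).+1 = size u, perm_eq I (iota o (n_internal R)) &
    Perm (pedges (x :: rcons I y) u)
         (map (emap (graft o [:: x; y] R)) (gedges R))].
Proof.
move=> hs; have [[okx _] sz _] := is_string_ok hs.
case: hs => ns [u0 hn hp he hx].
have /(perm_trans (perm_map _ hp)) : perm_eq _ _ :=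
  graft_perm o okx (esym sz : size [:: x; y] = _).
have := @graft_ext _ o [:: x; y] R (proj1 (andP okx)) (esym sz).
rewrite [in X in map _ X]hx.
case: ns hn {hp hx} he => // h ns; case/lastP: ns => [|J l];
  first by case: u u0.
rewrite /= size_rcons last_rcons => hn he [hx hy] hp.
exists (map (graft o [:: x; y] R) J); split; first by rewrite size_map;
  case: hn.
- move: hp; rewrite /= hx map_rcons hy perm_cons -cats1 perm_catC /=.
  by rewrite perm_cons.
- rewrite -[X in rcons _ X]hy -map_rcons -[X in X :: _]hx -map_cons pedges_map.
  exact: Perm_map.
Qed.

(** Edges need not be stored in path order. [E1] and [E2] split the edge list around the chosen
    edge, while [w1], [L1] and [w2], [L2] split the path; the two splittings agree only up to
    permutation. *)
Definition string_at {L} (G : graph L) E1 E2 w1 a d w2 : Prop :=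
  exists L1 x y L2,
  [/\ gedges G = E1 ++ pedge x y (a, d) :: E2,
      size w1 = size L1 /\ size w2 = size L2,
      perm_eq (L1 ++ x :: y :: L2) (iota 0 (gnv G)),
      Perm (pedges (rcons L1 x) w1 ++ pedges (y :: L2) w2) (E1 ++ E2) &
      gext G = [:: head x L1; last y L2]].

Lemma head_cat_cons {T} (z x : T) s t : head z (s ++ x :: t) = head x s.
Proof. by case: s. Qed.

Lemma string_atP {L} (G : graph L) w E1 a att E2 :
  is_string G w -> gedges G = E1 ++ (a, att) :: E2 ->
  exists w1 d w2, w = w1 ++ (a, d) :: w2 /\ string_at G E1 E2 w1 a d w2.
Proof.
case=> ns [w0 hs hp he hx] hG.
have /pedges_In[w1 [[b d] [w2 [L1 [x [y [L2 [hw h1 hns hb]]]]]]]] :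
    List.In (a, att) (pedges ns w).
  apply: (Permutation.Permutation_in _ (Perm_sym he)).
  by rewrite hG In_cat; right; left.
case: hb => ? hatt; subst b; exists w1, d, w2; split=> //.
exists L1, x, y, L2; split.
- by rewrite hG hatt.
- split=> //; move: hs; rewrite hns hw !size_cat /= h1; lia.
- by rewrite -hns.
- apply: (@Perm_cat_cons_inv _ _ _ _ _ (pedge x y (a, d))).
  by move: he; rewrite hns hw pedges_split // hG hatt.
- by rewrite hx hns head_cat_cons last_cat.
Qed.

Lemma string_at_gstr {L} w1 (a : L) d w2 :
  string_at (gstr (w1 ++ (a, d) :: w2)) (pedges (iota 0 (size w1).+1) w1)
    (pedges (iota (size w1).+1 (size w2).+1) w2) w1 a d w2.
Proof.
set n := size w1; set m := size w2.
exists (iota 0 n), n, n.+1, (iota n.+2 m).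
have hi : iota 0 (size (w1 ++ (a, d) :: w2)).+1 =
          iota 0 n ++ n :: n.+1 :: iota n.+2 m.
  by rewrite size_cat -addnS iotaD /= add0n.
have hi' : iota 0 n.+1 = rcons (iota 0 n) n by rewrite -addn1 iotaD cats1.
rewrite gstrE hi hi'; split.
- by rewrite [gedges _]/= pedges_split ?size_iota.
- by rewrite !size_iota.
- by rewrite -hi.
- exact: Permutation.Permutation_refl.
- rewrite [gext _]/=; congr [:: _; _]; first by rewrite /n; case: (size w1).
  rewrite -[last _ _]/(last 0 (iota n.+1 m.+1)) -nth_last size_iota nth_iota //.
  by rewrite size_cat /= addnS.
Qed.

(** An edge with [d = true] is traversed backwards by the path, so the string inserted for it is
    read backwards as well. *)
Lemma string_at_repl {L} (G R : graph L) E1 E2 w1 a d w2 u :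
  string_at G E1 E2 w1 a d w2 -> is_string R u ->
  is_string (repl G (size E1) R) (w1 ++ flipd d u ++ w2).
Proof.
move=> [L1 [x [y [L2 [hG [h1 h2] hp he hx]]]]] hR.
have [I [hI hpI heI]] :=
  string_graft (gnv G) (if d then y else x) (if d then x else y) hR.
(* [J] lists the inserted interior nodes in the order in which the outer path visits them. *)
pose J : seq nat := if d then rev I else I.
have hJ : (size J).+1 = size (flipd d u).
  by rewrite size_flipd -hI /J; case: (d); rewrite ?size_rev.
have hpJ : perm_eq J (iota (gnv G) (n_internal R)).
  by apply: perm_trans hpI; rewrite /J; case: (d); rewrite // perm_rev.
have heJ : Perm (pedges (x :: rcons J y) (flipd d u))
    (map (emap (graft (gnv G) (if d then [:: y; x] else [:: x;
      y]) R)) (gedges R)).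
  rewrite /J; case: (d) heI => //= heI; apply: Perm_trans heI.
  exact: Perm_pedges_flip.
rewrite (replE _ hG) /=.
exists (L1 ++ x :: J ++ y :: L2); split.
- by case: (u) hI => // b u' _; case: (w1) => //; case: (d) => //;
    rewrite /= /flip /= rev_cons; case: rev.
- by rewrite !size_cat /= !size_cat /= h1 h2; move: hJ; lia.
- rewrite /= iotaD add0n; apply/permP => z.
  move: (permP hp z) (permP hpJ z).
  rewrite !count_cat /= !count_cat /=; lia.
- rewrite pedges_cat // -cat_cons pedges_cat ?hJ //=.
  apply: Perm_trans (Perm_catCA _ _ _) _; apply: Perm_sym.
  apply: Perm_trans (Perm_catCA _ _ _) _; apply: Perm_cat; exact: Perm_sym.
- by rewrite /= hx head_cat_cons last_cat /= last_cat.
Qed.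

Lemma string_subst2 {A B} (a b : A) (rep : nat -> A -> nat -> graph B) u v :
  is_string (rep 0 a 2) u -> is_string (rep 1 b 2) v ->
  is_string (gsubst (strgraph [:: a; b]) rep) (u ++ v).
Proof.
move=> hu hv; rewrite gsubst2E.
set R := rep 0 a 2 in hu *; set R' := rep 1 b 2 in hv *.
have [I [hI hpI heI]] := string_graft 3 0 1 hu.
have [J [hJ hpJ heJ]] := string_graft (3 + n_internal R) 1 2 hv.
exists ((0 :: I) ++ 1 :: rcons J 2); split=> /=.
- by case: (u) hI.
- by rewrite !size_cat /= size_rcons -hJ -hI; lia.
- rewrite -cats1 -addnA iotaD; apply/permP => z.
  move: (permP hpI z) (permP hpJ z).
  rewrite /= iotaD addn0 !count_cat /= !count_cat /=; lia.
- by rewrite -cat_cons pedges_cat; [exact: Perm_cat | rewrite -hI].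
- by rewrite last_cat /= last_rcons.
Qed.

Lemma string_subst_rev {A B} (a : A) (rep : nat -> A -> nat -> graph B) u :
  is_string (rep 0 a 2) u ->
  is_string (gsubst (Graph 2 [:: (a, [:: 1; 0])] [:: 0; 1]) rep) (flip u).
Proof.
move=> hu; rewrite gsubst1E.
have [I [hI hpI heI]] := string_graft 2 1 0 hu.
exists (0 :: rcons (rev I) 1); split=> //=.
- by move/(congr1 size); rewrite size_flip -hI.
- by rewrite size_flip size_rcons size_rev hI.
- by rewrite perm_cons -cats1 perm_catC /= perm_cons perm_rev.
- apply: Perm_trans heI.
  exact: Perm_pedges_flip.
- by rewrite last_rcons.
Qed.

(** * Recovering words from the result of a replacement *)

Lemma string_ungraft {L} o s t (R : graph L) ns w :
  graph_ok R -> size (gext R) = 2 -> size ns = (size w).+1 -> uniq ns ->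
  perm_eq ns ([:: s; t] ++ iota o (n_internal R)) ->
  Perm (pedges ns w) (map (emap (graft o [:: s; t] R)) (gedges R)) ->
  head 0 ns = s -> last 0 ns = t ->
  is_string R w.
Proof.
move=> [okx oke] sz hs u hp he hh hl.
(* [ns] is duplicate-free and lists the images of the nodes of [R], so the path can be pulled back
   along an inverse of [graft]. *)
have [|g gK] := graft_inv (o := o) (att := [:: s; t]) okx (esym sz).
  by rewrite -(perm_uniq hp).
have gKs v : all (fun x => x < gnv R) v -> map g (map (graft o [:: s;
  t] R) v) = v.
  move=> /allP hv; rewrite -map_comp -[RHS]map_id; apply/eq_in_map => x xv.
  exact: gK (hv _ xv).
exists (map g ns); split.
- move=> w0; move: (perm_size hp); rewrite hs w0 /= size_iota; lia.
- by rewrite size_map.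
- apply: perm_trans (perm_map g hp) _; rewrite perm_sym.
  have := perm_map g (graft_perm o okx (esym sz : size [:: s; t] = _)).
  by rewrite gKs //; apply/allP => x; rewrite mem_iota.
- rewrite pedges_map; apply: Perm_trans (Perm_map _ he) _.
  rewrite -map_comp (eq_map_In (g := id)) ?map_id // => -[a att] hI.
  by rewrite /emap /= gKs //; case/andP: (oke _ hI).
- rewrite -[LHS]gKs; last by case/andP: okx.
  rewrite graft_ext //; last by case/andP: okx.
  by rewrite /= -hh -hl; case: ns hs {u hp he hh hl} => //= x ns _;
    rewrite last_map.
Qed.

Lemma last_uniq_nil (x : nat) s : uniq (x :: s) -> last x s = x -> s = [::].
Proof.
by case: s => //= y s /and3P[h _ _] E; move: h; rewrite -E mem_last.
Qed.

(** The edge [c] ends at the external node [2], so it is the last edge of the path and runs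
    forwards; what precedes it is a path through the copy of [F]. This inverts the premise of a
    right division rule. *)
Lemma string_unsubst_l {A L} (a b : A) c (F : graph L) rep w :
  graph_ok F -> size (gext F) = 2 -> rep 0 a 2 = F -> rep 1 b 2 = handle c 2 ->
  is_string (gsubst (strgraph [:: a; b]) rep) w ->
  exists2 u, w = rcons u (c, false) & is_string F u.
Proof.
move=> okF szF ra rb; rewrite gsubst2E ra rb n_internal_handle addn0.
rewrite (@graft_handle _ _ [:: 1; 2]) => hw.
have [w1 [d [w2 [-> [L1 [x [y [L2 [hG [h1 h2] hp he hx]]]]]]]]] :=
  string_atP hw (erefl _ : gedges (Graph _ _ _) = _ ++ (c, _) :: [::]).
have u : uniq (L1 ++ [:: x, y & L2]) by rewrite (perm_uniq hp) iota_uniq.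
rewrite /= in hG he hx; case: hx => hh hl.
have {hG} [? ? ? ] : [/\ d = false, x = 1 & y = 2].
  move/(congr1 (last (c, [::]))): hG; rewrite !last_cat /pedge /=.
  (* With [d = true] the node [2] would occur twice on the path, as [x] and as its last node. *)
  case: d => -[] ? ?; subst x y => //.
  move: u; rewrite cat_uniq /= !inE !negb_or => /and3P[_ _ /andP[/andP[_]]].
  by rewrite {1}hl; case: (L2) hl => //= z s ->; rewrite mem_last.
subst d x y.
have ? : L2 = [::].
  by apply: (@last_uniq_nil 2) => //; move: u;
    rewrite cat_uniq /= => /and3P[_ _ /andP[]].
subst L2; case: w2 h2 he => //= _; rewrite !cats0 => he.
exists w1; first by rewrite cats1.
have hc : L1 ++ [:: 1; 2] = rcons L1 1 ++ [:: 2] by rewrite -cats1 -catA.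
apply: (@string_ungraft _ 3 0 1 _ (rcons L1 1)) => //.
- by rewrite size_rcons h1.
- by move: u; rewrite hc cat_uniq => /and3P[].
- move: hp; rewrite hc perm_catC /= => hp.
  rewrite -(perm_cons 2); apply: perm_trans hp _.
  by rewrite /= -[2 :: iota _ _]cat1s (perm_catCA [:: 0; 1] [:: 2]).
- by rewrite -cats1 head_cat_cons.
- by rewrite last_rcons.
Qed.

Lemma string_unsubst_r {A L} (a b : A) c (F : graph L) rep w :
  graph_ok F -> size (gext F) = 2 -> rep 0 a 2 = handle c 2 -> rep 1 b 2 = F ->
  is_string (gsubst (strgraph [:: a; b]) rep) w ->
  exists2 u, w = (c, false) :: u & is_string F u.
Proof.
move=> okF szF ra rb; rewrite gsubst2E ra rb n_internal_handle addn0.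
rewrite (@graft_handle _ _ [:: 0; 1]) => hw.
have [w1 [d [w2 [-> [L1 [x [y [L2 [hG [h1 h2] hp he hx]]]]]]]]] :=
  string_atP hw (erefl _ : gedges (Graph _ _ _) = [::] ++ (c, _) :: _).
have u : uniq (L1 ++ [:: x, y & L2]) by rewrite (perm_uniq hp) iota_uniq.
rewrite /= in hG he hx; case: hx => hh hl.
have {hG} [? ? ? ] : [/\ d = false, x = 0 & y = 1].
  case: hG; rewrite /pedge /=.
  case: d => -[] ? ?; subst x y => //.
  move: u; rewrite cat_uniq /= !inE => /and3P[_ + _].
  by case: (L1) hh => //= z s <-; rewrite !inE eqxx /= orbT.
subst d x y.
have ? : L1 = [::].
  case: (L1) hh u => //= z s <-; rewrite mem_cat inE eqxx orbT //.
subst L1; case: w1 h1 he => //= _ he.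
exists w2 => //.
apply: (@string_ungraft _ 3 1 2 _ (1 :: L2)) => //.
- by rewrite /= h2.
- by case/andP: u.
- by move: hp; rewrite /= perm_cons.
Qed.

(** The inserted graph has no internal node, so the path stays the same and only the direction of
    one edge toggles. *)
Lemma string_unrev {L} (G : graph L) E1 E2 c s t a w :
  gedges G = E1 ++ (c, [:: s; t]) :: E2 ->
  is_string (repl G (size E1) (Graph 2 [:: (a, [:: 1; 0])] [:: 0; 1])) w ->
  exists w1 d w2, w = w1 ++ (a, d) :: w2 /\ is_string G (w1 ++ (c, ~~ d) :: w2).
Proof.
move=> hG; rewrite (replE _ hG) addn0.
rewrite -[map _ _]/[:: (a, [:: t; s])] => hw.
have [w1 [d [w2 [-> [L1 [x [y [L2 [/= hG' [h1 h2] hp he hx]]]]]]]]] :=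
  string_atP hw (erefl _ : gedges (Graph _ _ _) = E1 ++ (a, [:: t; s]) :: E2).
exists w1, d, w2; split=> //.
have hcs : (c, [:: s; t]) = pedge x y (c, ~~ d).
  move: hG' => /(congr1 (fun l => drop (size E1) l)); rewrite !drop_size_cat //.
  by rewrite /pedge /=; case: (d) => -[-> ->].
exists (L1 ++ [:: x, y & L2]); split=> //.
- by case: (w1).
- by rewrite !size_cat /= h1 h2; lia.
- rewrite pedges_split // hG hcs.
  apply: Permutation.Permutation_elt; exact: he.
- by rewrite hx head_cat_cons last_cat.
Qed.

Lemma filter_none {T} (p : pred T) s :
  (forall x, List.In x s -> ~~ p x) -> filter p s = [::].
Proof.
elim: s => //= x s IH h; rewrite (negbTE (h x _)) ?IH //; first by move=> y ?;
  apply: h; right.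
by left.
Qed.

Lemma filter_every {T} (p : pred T) s :
  (forall x, List.In x s -> p x) -> filter p s = s.
Proof.
elim: s => //= x s IH h; rewrite h ?IH //; first by move=> y ?; apply: h; right.
by left.
Qed.

(** As [n] differs from [s] and [t], mixed matchings are impossible: the path crosses [n] either
    from [s] to [t] or from [t] to [s], and [d] records which. *)
Lemma pedge_pair {L} p q n s t (a1 b1 a b : L) d1 d2 :
  s <> n -> t <> n ->
  Perm [:: pedge p n (a1, d1); pedge n q (b1, d2)]
       [:: (a, [:: s; n]); (b, [:: n; t])] ->
  exists d, [:: (a1, d1); (b1, d2)] = flipd d [:: (a, false); (b, false)] /\
    [:: p; q] = if d then [:: t; s] else [:: s; t].
Proof.
move=> sn tn hP; case: (Permutation.Permutation_length_2 hP) => -[] {hP};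
  rewrite /pedge /=; case: d1; case: d2 => h1 h2; try congruence.
- by exists false; rewrite /=; split; congruence.
- by exists true; split; rewrite /flipd /flip /rev /=; congruence.
Qed.

(** By [graph_ok G] all old nodes lie below [gnv G], so the new middle node meets none of the old
    edges. *)
Lemma string_unprod {L} (G : graph L) E1 E2 c att a b w :
  graph_ok G -> size att = 2 -> gedges G = E1 ++ (c, att) :: E2 ->
  is_string (repl G (size E1) (strgraph [:: a; b])) w ->
  exists w1 d w2, w = w1 ++ flipd d [:: (a, false); (b, false)] ++ w2 /\
    is_string G (w1 ++ (c, d) :: w2).
Proof.
case: att => [|s [|t []]] // [okx oke] _ hG; rewrite (replE _ hG).
have [st [s_n t_n]] : s != t /\ s < gnv G /\ t < gnv G.
  have := oke (c, [:: s; t]);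
    rewrite hG In_cat => /(_ (or_intror (or_introl erefl))).
  by rewrite /nodes_ok /= inE andbT => /and4P[? ? ?].
set n := gnv G.
have -> : map (emap (graft n [:: s; t] (strgraph [:: a;
  b]))) (gedges (strgraph [:: a; b]))
   = [:: (a, [:: s; n]); (b, [:: n;
     t])] by rewrite /= /emap /= /graft /= ?addn0.
rewrite /n_internal [count _ _]/= addn1.
case=> ns [w0 hs hp he /= hx].
have hh : head 0 ns \in gext G by rewrite hx mem_head.
have hl : last 0 ns \in gext G by rewrite hx !inE eqxx orbT.
have u : uniq ns by rewrite (perm_uniq hp) iota_uniq.
have n_ext v : v \in gext G -> v != n.
  by case/andP: okx => _ /allP h /h; rewrite neq_ltn => ->.
have n_ns : n \in ns by rewrite (perm_mem hp) mem_iota /=.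
(* [n] is not external, so it is neither end of the path and has a neighbour on each side. *)
have [I [p [q [J E]]]] : exists I p q J, ns = I ++ p :: n :: q :: J.
  case/splitPr: n_ns hh hl => s1 s2; rewrite head_cat_cons last_cat /= => hh hl.
  case/lastP: s1 hh => [/n_ext/=|I p _]; first by rewrite eqxx.
  case: s2 hl => [/n_ext/=|q J _]; first by rewrite eqxx.
  by exists I, p, q, J; rewrite -cats1 -catA.
have [w1 [[a1 d1] [[b1 d2] [w2 [Ew h1 h2]]]]] : exists w1 a1 b1 w2,
    [/\ w = w1 ++ [:: a1; b1] ++ w2, size w1 = size I & size w2 = size J].
  exists (take (size I) w); move: hs; rewrite E size_cat /= => hs.
  have : size (drop (size I) w) = (size J).+2 by rewrite size_drop; lia.
  case D : (drop (size I) w) => [|a1 [|b1 w2]] // [hJ].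
  exists a1, b1, w2; split; rewrite // -?D ?cat_take_drop // size_takel //; lia.
subst w ns.
have pe : pedges (I ++ [:: p, n, q & J]) (w1 ++ [:: (a1, d1); (b1, d2)] ++ w2) =
   pedges (rcons I p) w1 ++ [:: pedge p n (a1, d1); pedge n q (b1, d2)]
     ++ pedges (q :: J) w2 by rewrite pedges_split // pedges_cons.
rewrite pe in he.
have hn : uniq [:: n, p, q & I ++ J].
  rewrite (@perm_uniq _ _ (I ++ [:: p, n, q & J])) //.
  by apply/permP => z; rewrite /= !count_cat /=; lia.
move: hn => /= /and3P[];
  rewrite !inE !mem_cat !negb_or => /and3P[np nq /andP[nI nJ]] pq _.
have out1 e : List.In e (pedges (rcons I p) w1) -> n \notin e.2.
  move/pedges_sub => h; apply/negP => /h; rewrite mem_rcons inE.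
  by rewrite (negbTE np) (negbTE nI).
have out2 e : List.In e (pedges (q :: J) w2) -> n \notin e.2.
  move/pedges_sub => h; apply/negP => /h; rewrite inE.
  by rewrite (negbTE nq) (negbTE nJ).
have outG e : List.In e (E1 ++ E2) -> n \notin e.2.
  move=> hI; have : List.In e (gedges G).
    by rewrite hG In_cat; move: hI; rewrite In_cat /=; tauto.
  by move/oke => /andP[_ /allP h]; apply/negP => /h; rewrite ltnn.
have outG1 e : List.In e E1 -> n \notin e.2 by move=> h; apply: outG;
  rewrite In_cat; left.
have outG2 e : List.In e E2 -> n \notin e.2 by move=> h; apply: outG;
  rewrite In_cat; right.
have inp : n \in (pedge p n (a1, d1)).2 by case: (d1); rewrite !inE eqxx ?orbT.
have inq : n \in (pedge n q (b1, d2)).2 by case: (d2); rewrite !inE eqxx ?orbT.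
(* Incidence with [n] splits both edge lists: [hP] compares the two edges at [n], [hQ] all the
   others. *)
have hP := Perm_filter (fun e : L * seq nat => n \in e.2) he.
have hQ := Perm_filter (fun e : L * seq nat => n \notin e.2) he.
have hneg (s' : seq (L * seq nat)) : (forall e, List.In e s' -> n \notin e.2) ->
    filter (fun e : L * seq nat => n \in e.2) s' = [::] by apply: filter_none.
have hpos (s' : seq (L * seq nat)) : (forall e, List.In e s' -> n \notin e.2) ->
    filter (fun e : L * seq nat => n \notin e.2) s' = s' by apply: filter_every.
move: hP;
  rewrite !filter_cat !(hneg (pedges _ _)) // (hneg E1) // (hneg E2) // cats0.
rewrite [filter _ _]/= inp inq /= !inE eqxx !orbT /= => hP.
move: hQ; rewrite !filter_cat !(hpos (pedges _ _)) // (hpos E1) // (hpos E2) //.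
rewrite [filter _ [:: pedge _ _ _; _]]/= inp inq /= !inE eqxx !orbT /= => hQ.
have hi : perm_eq (iota 0 n.+1) (n :: iota 0 n).
  by rewrite -[n.+1]addn1 iotaD cats1 perm_rcons.
(* Deleting [n] and joining [p] to [q] by the edge [c] gives the path of [G]. *)
have fin d : (c, [:: s; t]) = pedge p q (c, d) ->
    is_string G (w1 ++ (c, d) :: w2).
  move=> Ec; exists (I ++ p :: q :: J); split.
  - by case: (w1).
  - by rewrite !size_cat /= h1 h2 addnS.
  - rewrite -(perm_cons n). 
    have pqn : perm_eq (n :: I ++ [:: p, q & J]) (I ++ [:: p, n, q & J]).
      by clear; apply/permP => z; rewrite /= !count_cat /=; lia.
    apply: (perm_trans pqn). apply: (perm_trans hp). exact: hi.
 - rewrite pedges_split // hG Ec; apply: Permutation.Permutation_elt; exact: hQ.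
 - by rewrite hx !head_cat_cons !last_cat.
have sn : s <> n by move=> E; rewrite E ltnn in s_n.
have tn : t <> n by move=> E; rewrite E ltnn in t_n.
have [d [Ew Ed]] := pedge_pair sn tn hP.
exists w1, d, w2; split; first by rewrite -Ew.
by apply: fin; case: (d) Ed => -[-> ->].
Qed.

(** * Translated types *)

(** The position of the [$] tells the two divisions apart, and the number of edges tells product
    from reversal. *)
Lemma trR_inj : injective trR.
Proof.
elim=> [p|B IHB A IHA|A IHA B IHB|A IHA B IHB|A IHA] [q|B' A'|A' B'|A' B'|A'] //=.
- by case=> ->.
- by case=> /IHA-> /IHB->.
- by case=> /IHA-> /IHB->.
- by case=> /IHA-> /IHB->.
- by case=> /IHA->.
Qed.

Lemma arity_trR A : htype_arity (trR A) = 2.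
Proof. by case: A. Qed.

Lemma graph_ok_strgraph2 {L} (a b : L) : graph_ok (strgraph [:: a; b]).
Proof. by split=> // e /= [<-|[<-|[]]]. Qed.

Lemma wf_trR A : wf_type (trR A).
Proof.
elim: A => [p|B IHB A IHA|A IHA B IHB|A IHA B IHB|A IHA] /=.
- exact: wf_prim.
- apply: wf_div; rewrite ?arity_trR //; first exact: graph_ok_strgraph2.
  by move=> t att /= [[<- <-]|[|[]]] //; rewrite arity_trR.
- apply: wf_div; rewrite ?arity_trR //; first exact: graph_ok_strgraph2.
  by move=> t att /= [|[[<- <-]|[]]] //; rewrite arity_trR.
- apply: wf_times; first exact: graph_ok_strgraph2.
  by move=> t att /= [[<- <-]|[[<- <-]|[]]]; rewrite arity_trR.
- apply: wf_times; first by split=> // e /= [<-|[]].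
  by move=> t att /= [[<- <-]|[]]; rewrite arity_trR.
Qed.

Definition trw (w : seq (ltp * bool)) : seq (htype * bool) :=
  [seq (trR a.1, a.2) | a <- w].

Lemma trw_inj : injective trw.
Proof. by apply: inj_map => -[A d] [B e] /= [/trR_inj-> ->]. Qed.

Lemma trw_cat u v : trw (u ++ v) = trw u ++ trw v.
Proof. exact: map_cat. Qed.

Lemma size_trw w : size (trw w) = size w.
Proof. exact: size_map. Qed.

Lemma trw_nil w : w <> [::] -> trw w <> [::].
Proof. by case: w. Qed.

Lemma trw_flipd d w : trw (flipd d w) = flipd d (trw w).
Proof. by case: d => //; rewrite /trw /flipd /flip map_rev -!map_comp. Qed.

Lemma trw_split w w1 u w2 :
  trw w = w1 ++ trw u ++ w2 ->
  exists v1 v2, [/\ w = v1 ++ u ++ v2, w1 = trw v1 & w2 = trw v2].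
Proof.
move=> E.
have hs := congr1 size E; rewrite !size_cat !size_map in hs.
have E1 : w1 = trw (take (size w1) w).
  by have := congr1 (take (size w1)) E; rewrite take_size_cat // -map_take.
have E2 : trw u ++ w2 = trw (drop (size w1) w).
  by have := congr1 (drop (size w1)) E; rewrite drop_size_cat // -map_drop.
have E3 : u = take (size u) (drop (size w1) w).
  apply: trw_inj; have := congr1 (take (size u)) E2.
  by rewrite -{1}(size_trw u) take_size_cat // -map_take.
have E4 : w2 = trw (drop (size u) (drop (size w1) w)).
  have := congr1 (drop (size u)) E2.
  by rewrite -{1}(size_trw u) drop_size_cat // -map_drop.
exists (take (size w1) w), (drop (size u) (drop (size w1) w)); split=> //.
by rewrite {1}E3 !cat_take_drop.
Qed.

(** The side condition [wf_seq] of the HL rules is thus automatic on string graphs with translated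
    labels. *)
Lemma string_wf (G : graph htype) w C : is_string G (trw w) -> wf_seq G (trR C).
Proof.
move=> hs; have [ok sz he] := is_string_ok hs.
split=> //; split; last by rewrite arity_trR; split; first exact: wf_trR.
move=> t att hI.
have : List.In t (map fst (trw w)).
  apply: Permutation.Permutation_in (Perm_sym (is_string_labels hs)) _.
  by apply/In_map; exists (t, att).
rewrite -map_comp => /In_map[[A d] [/= <- _]]; rewrite arity_trR (he _ hI).
by split=> //; exact: wf_trR.
Qed.

(** * String rules derivable in HL *)

Definition divL_rep N D (Hs : nat -> graph htype) (j : nat) (l : option htype)
    (k : nat) : graph htype :=
  if l is None then handle (Div N D) k else Hs j.

Definition hls w C : Prop := hl_der (gstr (trw w)) (trR C).

Lemma hls_of G w C : is_string G (trw w) -> hl_der G (trR C) -> hls w C.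
Proof.
move=> hs hd; apply: hl_iso hd _; apply: (string_giso hs).
by apply: gstr_string; case: hs => ns [].
Qed.

Lemma hls_to G w C : is_string G (trw w) -> hls w C -> hl_der G (trR C).
Proof.
move=> hs hd; apply: hl_iso hd _; apply: string_giso (hs).
by apply: gstr_string; case: hs => ns [].
Qed.

Lemma flipd1 {L} d (a : L) : flipd d [:: (a, false)] = [:: (a, d)].
Proof. by case: d. Qed.

Lemma string_strgraph2 {L} (a b : L) :
  is_string (strgraph [:: a; b]) [:: (a, false); (b, false)].
Proof. exact: (gstr_string (w := [:: (a, false); (b, false)])). Qed.

Lemma string_handle {L} (a : L) : is_string (handle a 2) [:: (a, false)].
Proof. by exists [:: 0; 1]; split. Qed.

Lemma string_rev {L} (a : L) :
  is_string (Graph 2 [:: (a, [:: 1; 0])] [:: 0; 1]) [:: (a, true)].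
Proof. by exists [:: 0; 1]; split. Qed.

Lemma string_at_nth {L} (G : graph L) E1 E2 w1 a d w2 :
  string_at G E1 E2 w1 a d w2 ->
  exists att, List.nth_error (gedges G) (size E1) = Some (a, att).
Proof.
case=> [L1 [x [y [L2 [-> _ _ _ _]]]]]; exists (pedge x y (a, d)).2.
exact: nth_error_mid.
Qed.

Lemma hls_ax p : hls [:: (LP p, false)] (LP p).
Proof. exact: (hl_ax p 2). Qed.

Lemma hls_timesL X F u G d D C :
  trR X = Times F -> is_string F (trw u) ->
  hls (G ++ flipd d u ++ D) C -> hls (G ++ flipd d [:: (X, false)] ++ D) C.
Proof.
rewrite flipd1 /= => hX hF hd; rewrite /hls trw_cat /= hX.
have hat := string_at_gstr (trw G) (Times F) d (trw D).
have hst :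
    is_string (gstr (trw G ++ (Times F, d) :: trw D)) (trw (G ++ (X, d) :: D)).
  by rewrite trw_cat /= hX; apply: gstr_string; case: (trw G).
have [att he] := string_at_nth hat.
apply: (hl_timesL he) _ (string_wf _ hst).
apply: hls_to hd; rewrite !trw_cat trw_flipd; exact: (string_at_repl hat).
Qed.

Lemma hls_divL X N D Hs v G d E C :
  trR X = Div (trR N) D ->
  (forall j t att, List.nth_error (gedges D) j = Some (Some t, att) ->
     hl_der (Hs j) t) ->
  is_string (gsubst D (divL_rep (trR N) D Hs)) (trw v) ->
  hls (G ++ flipd d [:: (N, false)] ++ E) C -> hls (G ++ flipd d v ++ E) C.
Proof.
move=> hX hH hv; rewrite flipd1 /= => hd.
have hat := string_at_gstr (trw G) (trR N) d (trw E).
have hr := string_at_repl hat hv; rewrite -trw_flipd -!trw_cat in hr.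
have [att he] := string_at_nth hat.
apply: (hls_of hr); apply: (hl_divL he) hH _ (string_wf _ hr).
- by move: hd; rewrite /hls trw_cat.
- by rewrite -hX; exact: wf_trR.
Qed.

Lemma hls_divR X N D u v :
  trR X = Div (trR N) D -> u <> [::] ->
  is_string (gsubst D (fun _ l k => match l with
                                    | None => gstr (trw u)
                                    | Some t => handle t k
                                    end)) (trw v) ->
  hls v N -> hls u X.
Proof.
move=> hX u0 hv hd; rewrite /hls hX; apply: hl_divR.
  exact: hls_to hv hd.
rewrite -hX; apply: string_wf; exact: gstr_string (trw_nil u0).
Qed.

Lemma hls_divLL u A B G d D C :
  u <> [::] -> hls u A -> hls (G ++ flipd d [:: (B, false)] ++ D) C ->
  hls (G ++ flipd d (u ++ [:: (LDivL A B, false)]) ++ D) C.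
Proof.
move=> u0 hu; apply: (@hls_divL (LDivL A B) _ _ (fun _ => gstr (trw u))) => //.
- by case=> [|[|[]]] // t att /= [<-].
- by rewrite trw_cat; apply: string_subst2;
    [exact: gstr_string (trw_nil u0) | exact: string_handle].
Qed.

Lemma hls_divRL u A B G d D C :
  u <> [::] -> hls u A -> hls (G ++ flipd d [:: (B, false)] ++ D) C ->
  hls (G ++ flipd d ((LDivR B A, false) :: u) ++ D) C.
Proof.
move=> u0 hu; apply: (@hls_divL (LDivR B A) _ _ (fun _ => gstr (trw u))) => //.
- by case=> [|[|[]]] // t att /= [<-].
- by rewrite -[_ :: u]cat1s trw_cat; apply: string_subst2;
    [exact: string_handle | exact: gstr_string (trw_nil u0)].
Qed.

Lemma hls_divLR u A B :
  u <> [::] -> hls ((A, false) :: u) B -> hls u (LDivL A B).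
Proof.
move=> u0; apply: (hls_divR _ u0) => //.
by rewrite -[_ :: u]cat1s trw_cat; apply: string_subst2;
  [exact: string_handle | exact: gstr_string (trw_nil u0)].
Qed.

Lemma hls_divRR u A B :
  u <> [::] -> hls (u ++ [:: (A, false)]) B -> hls u (LDivR B A).
Proof.
move=> u0; apply: (hls_divR _ u0) => //.
by rewrite trw_cat; apply: string_subst2;
  [exact: gstr_string (trw_nil u0) | exact: string_handle].
Qed.

Lemma hls_prodL A B G d D C :
  hls (G ++ flipd d [:: (A, false); (B, false)] ++ D) C ->
  hls (G ++ flipd d [:: (LProd A B, false)] ++ D) C.
Proof. by apply: hls_timesL => //; exact: string_strgraph2. Qed.

Lemma hls_revL A G d D C :
  hls (G ++ flipd d [:: (A, true)] ++ D) C ->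
  hls (G ++ flipd d [:: (LRev A, false)] ++ D) C.
Proof. by apply: hls_timesL => //; exact: string_rev. Qed.

Lemma hls_prodR u v A B :
  u <> [::] -> v <> [::] -> hls u A -> hls v B -> hls (u ++ v) (LProd A B).
Proof.
move=> u0 v0 hu hv.
pose Hs i := if i is 0 then gstr (trw u) else gstr (trw v).
have hs : is_string (gsubst (strgraph [:: trR A;
  trR B]) (fun j _ _ => Hs j)) (trw (u ++ v)).
  by rewrite trw_cat; apply: string_subst2; exact/gstr_string/trw_nil.
apply: (hls_of hs); apply: hl_timesR;
  last exact: (@string_wf _ _ (LProd A B) hs).
by case=> [|[|[]]] // t att /= [<-].
Qed.

Lemma hls_revR u A : u <> [::] -> hls u A -> hls (flip u) (LRev A).
Proof.
move=> u0 hu.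
have hs : is_string (gsubst (Graph 2 [:: (trR A, [:: 1; 0])] [:: 0; 1])
    (fun _ _ _ => gstr (trw u))) (trw (flip u)).
  by rewrite (trw_flipd true); apply: string_subst_rev;
    exact/gstr_string/trw_nil.
apply: (hls_of hs); apply: (@hl_timesR _ (fun _ => _));
  last exact: (@string_wf _ _ (LRev A) hs).
by case=> [|[]] // t att /= [<-].
Qed.

(** * Closed sets of words *)

Notation word := (seq (ltp * bool)).

(** A biorthogonal closure: the nonempty words accepted by every context that accepts all of [X].
    Contexts carry a direction [d] because in HL a word may also occur flipped. *)
Definition cl (X : word -> Prop) (w : word) : Prop :=
  w <> [::] /\
  forall G D d C, (forall v, X v -> hls (G ++ flipd d v ++ D) C) ->
    hls (G ++ flipd d w ++ D) C.

Definition closed (X : word -> Prop) := forall w, cl X w -> X w.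

(** Only the product takes a closure, since concatenations of closed sets need not be closed; the
    other clauses preserve closedness. *)
Fixpoint den (A : ltp) (w : word) : Prop :=
  match A with
  | LP p => w <> [::] /\ hls w (LP p)
  | LDivL A B => w <> [::] /\ forall u, den A u -> den B (u ++ w)
  | LDivR B A => w <> [::] /\ forall u, den A u -> den B (w ++ u)
  | LProd A B =>
      cl (fun w => exists u v, [/\ den A u, den B v & w = u ++ v]) w
  | LRev A => den A (flip w)
  end.

Lemma flip_nil {L} (w : seq (L * bool)) : flip w <> [::] -> w <> [::].
Proof. by case: w. Qed.

Lemma den_nil A w : den A w -> w <> [::].
Proof.
elim: A w => [p|B IHB A IHA|A IHA B IHB|A IHA B IHB|A IHA] w /=; try by case.
by move/IHA/flip_nil.
Qed.

Lemma cat_nil {T} (s t : seq T) : s <> [::] \/ t <> [::] -> s ++ t <> [::].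
Proof. by case: s => //=; case. Qed.

(** A context around [g ++ v ++ k] is also a context around [v], with the two sides exchanged when
    the direction is reversed. This makes divisions into closed sets closed. *)
Lemma cl_frame (X Y : word -> Prop) g x k :
  closed Y -> (forall v, X v -> Y (g ++ v ++ k)) -> cl X x -> Y (g ++ x ++ k).
Proof.
move=> clY XY [x0 hx]; apply: clY; split.
  by apply: cat_nil; right; apply: cat_nil; left.
move=> G D d C hY; case: d hY => /= hY.
  rewrite !flip_cat -!catA catA; apply: (hx _ _ true) => v hv.
  by have := hY _ (XY _ hv); rewrite !flip_cat -!catA.
rewrite -!catA catA; apply: (hx _ _ false) => v hv /=.
by have := hY _ (XY _ hv); rewrite -!catA.
Qed.

Lemma den_closed A : closed (den A).
Proof.
elim: A => [p|B IHB A IHA|A IHA B IHB|A IHA B IHB|A IHA] w /=.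
- move=> [w0 h]; split=> //.
  (* The closure is tested in the empty context, with [LP p] itself as succedent. *)
  have := h [::] [::] false (LP p); rewrite /= cats0; apply=> v.
  by rewrite cats0 => -[].
- move=> h; split; first by case: h.
  move=> u hu; rewrite -[w]cats0; apply: cl_frame IHA _ h => v [_ hv].
  by rewrite cats0; apply: hv.
- move=> h; split; first by case: h.
  by move=> u hu; apply: (cl_frame (g := [::]) IHA) h => v [_]; apply.
- move=> [w0 h]; split=> // G D d C hX; apply: h => v [_ hv]; exact: hv.
- move=> [w0 h]; apply: IHA; split.
    by apply: flip_nil; rewrite flipK.
  move=> G D d C hX; rewrite flipd_flip; apply: h => v hv.
  by rewrite -flipd_flip; apply: hX.
Qed.

(** Both halves go through one induction: for a division, each half uses the opposite half at the
    denominator. *)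
Lemma den_base A : den A [:: (A, false)] /\ forall w, den A w -> hls w A.
Proof.
elim: A => [p|A IHA B IHB|B IHB A IHA|A IHA B IHB|A IHA].
- split; last by move=> w [].
  by split=> //; exact: hls_ax.
- case: IHA IHB => [hA sA] [hB sB]; split.
    split=> // u hu; apply: den_closed; split.
      by apply: cat_nil; right.
    move=> G D d C h; apply: hls_divLL (h _ hB); first exact: den_nil hu.
    exact: sA.
  (* Supplying the one-letter word [A] turns membership in the division into the premise of the
     right rule. *)
  by move=> w [w0 hw]; apply: hls_divLR => //; apply: sB; exact: hw hA.
- case: IHA IHB => [hA sA] [hB sB]; split.
    split=> // u hu; apply: den_closed; split => //.
    move=> G D d C h; apply: hls_divRL (h _ hB); first exact: den_nil hu.
    exact: sA.
  by move=> w [w0 hw]; apply: hls_divRR => //; apply: sB; exact: hw hA.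
- case: IHA IHB => [hA sA] [hB sB]; split.
    split=> // G D d C h; apply: hls_prodL; apply: h.
    by exists [:: (A, false)], [:: (B, false)].
  move=> w [w0 h]; have := h [::] [::] false (LProd A B); rewrite /= cats0.
  apply=> v [u1 [u2 [h1 h2 ->]]]; rewrite cats0.
  by apply: hls_prodR;
    [exact: den_nil h1 | exact: den_nil h2 | exact: sA | exact: sB].
- case: IHA => [hA sA]; split.
    apply: den_closed; split=> // G D d C h.
    by apply: hls_revL; apply: h.
  move=> w /= h; rewrite -[w]flipK; apply: hls_revR; last exact: sA.
  exact: den_nil h.
Qed.

Fixpoint dens (G : seq ltp) (w : word) : Prop :=
  match G with
  | [::] => w = [::]
  | A :: G' => exists u v, [/\ w = u ++ v, den A u & dens G' v]
  end.

Lemma dens1 A w : dens [:: A] w <-> den A w.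
Proof.
split=> [[u [v [-> hu ->]]]|h]; first by rewrite cats0.
by exists w, [::]; rewrite cats0.
Qed.

Lemma dens_nil G w : G <> [::] -> dens G w -> w <> [::].
Proof.
case: G => // A G _ [u [v [-> hu _]]]; apply: cat_nil; left; exact: den_nil hu.
Qed.

Lemma dens_cat G H w :
  dens (G ++ H) w <-> exists u v, [/\ w = u ++ v, dens G u & dens H v].
Proof.
elim: G w => [|A G IH] w /=.
  by split=> [h|[u [v [-> -> ?]]]] //; exists [::], w.
split.
  move=> [u [v [-> hu /IH[v1 [v2 [-> h1 h2]]]]]].
  by exists (u ++ v1), v2; rewrite catA; split=> //; exists u, v1.
move=> [u [v [-> [u1 [u2 [-> h1 h2]]] hv]]].
by exists u1, (u2 ++ v); rewrite catA; split=> //; apply/IH; exists u2, v.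
Qed.

Lemma dens_seqR G w : dens (seqR G) w -> dens G (flip w).
Proof.
elim: G w => [|A G IH] w; first by move=> /= ->.
rewrite /seqR rev_cons map_rcons -cats1 => /dens_cat[u [v [-> /IH hu /dens1 hv]]].
by rewrite flip_cat; exists (flip v), (flip u).
Qed.

(** Cut only replaces a factor by a word of the same denotation; left product is where closedness of
    the succedent enters. *)
Lemma dens_sound G C : lr_der G C -> forall w, dens G w -> den C w.
Proof.
elim=> {G C}.
- by move=> p w /dens1.
- move=> Pi A G B D C _ _ IH1 _ IH2 w /dens_cat[g [x [-> hg]]].
  move=> /dens_cat[u [y [-> hu]]] [v [k [-> [_ hv] hk]]].
  apply: IH2; apply/dens_cat; exists g, ((u ++ v) ++ k); rewrite !catA;
    split=> //.
  by exists (u ++ v), k; split=> //; apply: hv; apply: IH1.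
- move=> A Pi B Pi0 _ IH w hw; split; first exact: dens_nil hw.
  by move=> u hu; apply: IH; exists u, w.
- move=> G A B D C _ IH w /dens_cat[g [y [-> hg]]] [x [k [-> hx hk]]].
  apply: cl_frame (@den_closed C) _ hx => v [u1 [u2 [h1 h2 ->]]].
  apply: IH; apply/dens_cat; exists g, ((u1 ++ u2) ++ k); split=> //.
  by rewrite -catA; exists u1, (u2 ++ k); split=> //; exists u2, k.
- move=> Pi A G B D C _ _ IH1 _ IH2 w /dens_cat[g [x [-> hg]]].
  move=> [v [y [-> [_ hv] /dens_cat[u [k [-> hu hk]]]]]].
  apply: IH2; apply/dens_cat; exists g, ((v ++ u) ++ k); rewrite !catA;
    split=> //.
  by exists (v ++ u), k; split=> //; apply: hv; apply: IH1.
- move=> Pi A B Pi0 _ IH w hw; split; first exact: dens_nil hw.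
  by move=> u hu; apply: IH; apply/dens_cat; exists w, u; split=> //;
    apply/dens1.
- move=> Pi Psi A B _ _ _ IH1 _ IH2 w /dens_cat[u [v [-> hu hv]]].
  split; first by apply: cat_nil; left; exact: den_nil (IH1 _ hu).
  by move=> G D d C; apply; exists u, v; split; [exact: IH1 | exact: IH2 |].
- by move=> G C _ IH w /dens_seqR/IH.
- move=> G A D C _ IH w /dens_cat[g [y [-> hg]]] [x [k [-> hx hk]]].
  apply: IH; apply/dens_cat; exists g, (x ++ k); split=> //.
  by exists x, k; rewrite /= flipK.
- by move=> Pi C _ IH w /IH /=; rewrite flipK.
- move=> Pi A G D B _ IH1 _ IH2 w /dens_cat[g [x [-> hg]]].
  move=> /dens_cat[u [k [-> hu hk]]].
  apply: IH2; apply/dens_cat; exists g, (u ++ k); split=> //.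
  by exists u, k; split=> //; apply: IH1.
Qed.

(** The word of [G] lies in [dens G] letter by letter, so soundness places it in [den C], all of
    whose words derive [C] in HL. *)
Lemma lr_hls G C : lr_der G C -> hls [seq (A, false) | A <- G] C.
Proof.
move=> h; apply: (den_base C).2; apply: dens_sound h _ _.
elim: G => //= A G IH; exists [:: (A, false)], [seq (A, false) | A <- G].
by split=> //; exact: (den_base A).1.
Qed.

(** * Rules for bracketed words derivable in the Lambek calculus *)

Lemma lr_id A : lr_der [:: A] A.
Proof.
elim: A => [p|B IHB A IHA|A IHA B IHB|A IHA B IHB|A IHA].
- exact: lr_ax.
- apply: lr_divLR => //.
  exact: (@lr_divLL [:: B] B [::] A [::]).
- apply: lr_divRR => //.
  exact: (@lr_divRL [:: B] B [::] A [::]).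
- apply: (@lr_prodL [::]); exact: (@lr_prodR [:: A] [:: B]).
- exact: (lr_rev IHA).
Qed.

Lemma seqR_cat X Y : seqR (X ++ Y) = seqR Y ++ seqR X.
Proof. by rewrite /seqR rev_cat map_cat. Qed.

Lemma lr_seqRR G X D C :
  lr_der (G ++ seqR (seqR X) ++ D) C -> lr_der (G ++ X ++ D) C.
Proof.
elim: X G => // A X IH G.
rewrite -[A :: X]cat1s !seqR_cat -!catA /= => /lr_rrL.
by rewrite -!cat_rcons => /IH.
Qed.

(** Together with [lr_unrev_ctx] this passes to the mirrored sequent and back, so that a rule can be
    applied inside a reversed block. *)
Lemma lr_rev_ctx G X D C :
  lr_der (G ++ seqR X ++ D) C -> lr_der (seqR D ++ X ++ seqR G) (LRev C).
Proof.
by move=> /lr_rev; rewrite !seqR_cat -catA; apply: lr_seqRR.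
Qed.

Lemma lr_unrev_ctx G X D C :
  lr_der (seqR D ++ X ++ seqR G) (LRev C) -> lr_der (G ++ seqR X ++ D) C.
Proof.
move=> /lr_rev; rewrite !seqR_cat -catA => /lr_rrR /(lr_seqRR (G := [::])).
by rewrite /= catA -[seqR (seqR D)]cats0 => /lr_seqRR; rewrite cats0 -catA.
Qed.

Definition brw (w : seq (ltp * bool)) : seq ltp :=
  [seq bracketR a.1 a.2 | a <- w].

Lemma brw_cat u v : brw (u ++ v) = brw u ++ brw v.
Proof. exact: map_cat. Qed.

(** [seqR] puts a second reversal on letters already reversed, whereas [flip] removes the first;
    [lr_rrL] bridges the difference. *)
Lemma brw_flip_ctx G u D C :
  lr_der (G ++ seqR (brw u) ++ D) C -> lr_der (G ++ brw (flip u) ++ D) C.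
Proof.
elim: u D => // -[A d] u IH D.
rewrite -[_ :: u]cat1s brw_cat seqR_cat flip_cat brw_cat -!catA => h.
apply: IH; case: d h => //=; rewrite catA => /lr_rrL; by rewrite -catA.
Qed.

Lemma brw_flip u A : lr_der (brw u) A -> lr_der (brw (flip u)) (LRev A).
Proof.
move=> /lr_rev; rewrite -[seqR _]cats0 => /(brw_flip_ctx (G := [::])).
by rewrite cats0.
Qed.

(** A backward occurrence of [A] reads as [LRev A], which [flip u] derives, so cut covers both
    directions. *)
Lemma brw_sub u A G d D C :
  lr_der (brw u) A -> lr_der (brw (G ++ flipd d [:: (A, false)] ++ D)) C ->
  lr_der (brw (G ++ flipd d u ++ D)) C.
Proof.
rewrite !brw_cat; case: d => hu; last exact: lr_cut.
exact/lr_cut/brw_flip.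
Qed.

Lemma brw_divLL u A B G d D C :
  u <> [::] -> lr_der (brw u) A ->
  lr_der (brw (G ++ flipd d [:: (B, false)] ++ D)) C ->
  lr_der (brw (G ++ flipd d (u ++ [:: (LDivL A B, false)]) ++ D)) C.
Proof.
move=> u0 hu; apply: brw_sub; rewrite brw_cat.
apply: (@lr_divLL (brw u) A [::] B [::]) => //; last exact: lr_id.
by case: (u) u0.
Qed.

Lemma brw_divRL u A B G d D C :
  u <> [::] -> lr_der (brw u) A ->
  lr_der (brw (G ++ flipd d [:: (B, false)] ++ D)) C ->
  lr_der (brw (G ++ flipd d ((LDivR B A, false) :: u) ++ D)) C.
Proof.
move=> u0 hu; apply: brw_sub; rewrite /= -[brw u]cats0.
apply: (@lr_divRL (brw u) A [::] B [::]) => //; last exact: lr_id.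
by case: (u) u0.
Qed.

(** Two neighbouring letters merge here, which is not a substitution for a single type as in
    [brw_sub]; the reversed case is handled by mirroring the sequent. *)
Lemma brw_prodL A B G d D C :
  lr_der (brw (G ++ flipd d [:: (A, false); (B, false)] ++ D)) C ->
  lr_der (brw (G ++ flipd d [:: (LProd A B, false)] ++ D)) C.
Proof.
rewrite !brw_cat; case: d; last exact: lr_prodL.
rewrite -[brw (flipd _ _)]/(seqR [:: A;
  B]) -[brw (flipd _ _)]/(seqR [:: LProd A B]).
by move=> /lr_rev_ctx h; apply: lr_unrev_ctx; exact: lr_prodL.
Qed.

(** For [d = true] both bracketings coincide; for [d = false] a double reversal is removed by
    cut. *)
Lemma brw_revL A G d D C :
  lr_der (brw (G ++ (A, d) :: D)) C ->
  lr_der (brw (G ++ (LRev A, ~~ d) :: D)) C.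
Proof.
rewrite !brw_cat; case: d => //= h.
apply: (@lr_cut [:: LRev (LRev A)]) h; apply: lr_rrR.
exact: (lr_rev (lr_rev (lr_id A))).
Qed.

(** * From HL back to the Lambek calculus *)

(** Labels survive replacement, which lets the assumption that a conclusion has only translated
    labels pass to the premises. *)
Lemma glue_label {L} o (l : seq (seq nat * graph L)) j att R t a :
  List.nth_error l j = Some (att, R) -> List.In (t, a) (gedges R) ->
  exists a', List.In (t, a') (glue o l).2.
Proof.
elim: l o j => [|[att' R'] l IH] o [|j] //; rewrite glue_cons.
  move=> [_ ->] hI; eexists; apply/In_cat; left; apply/In_map.
  by exists (t, a).
move=> hj hI; have [a' h] := IH (o + n_internal R') j hj hI.
by exists a'; apply/In_cat; right.
Qed.

Lemma nth_error_map {T U} (f : T -> U) s n x :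
  List.nth_error s n = Some x -> List.nth_error (map f s) n = Some (f x).
Proof. by elim: s n => [|y s IH] [|n] //= => [[->]|/IH]. Qed.

Lemma nth_error_zip_iota {T} (s : seq T) k n x :
  List.nth_error s n = Some x ->
  List.nth_error (zip (iota k (size s)) s) n = Some (k + n, x).
Proof.
elim: s k n => [|y s IH] k [|n] //= => [[->]|/(IH k.+1)->];
  first by rewrite addn0.
by rewrite addnS.
Qed.

Lemma gsubst_label {A B} (G : graph A) (rep : nat -> A -> nat -> graph B)
    j l att t a :
  List.nth_error (gedges G) j = Some (l, att) ->
  List.In (t, a) (gedges (rep j l (size att))) ->
  exists a', List.In (t, a') (gedges (gsubst G rep)).
Proof.
move=> hj; apply: glue_label.
exact: (nth_error_map (fun ie => (ie.2.2, rep ie.1 ie.2.1 (size ie.2.2)))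
  (nth_error_zip_iota 0 hj)).
Qed.

Lemma repl_label {L} (G R : graph L) E1 a att E2 t b :
  gedges G = E1 ++ (a, att) :: E2 ->
  List.In (t, b) (E1 ++ E2) \/ List.In (t, b) (gedges R) ->
  exists b', List.In (t, b') (gedges (repl G (size E1) R)).
Proof.
move=> hG; rewrite (replE _ hG) /= In_cat => -[[]|] hI.
- by exists b; apply/In_cat; left.
- by exists b; apply/In_cat; right; apply/In_cat; right.
- eexists; apply/In_cat; right; apply/In_cat; left; apply/In_map.
  by exists (t, b).
Qed.

Lemma count_nth_error {T} (p : pred T) s :
  0 < count p s -> exists n x, List.nth_error s n = Some x /\ p x.
Proof.
elim: s => //= x s IH; case px: (p x); first by exists 0, x.
by move=> /IH[n [y [h1 h2]]]; exists n.+1, y.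
Qed.

Lemma string_neq0 {L} (G : graph L) w : is_string G w -> w <> [::].
Proof. by case=> ns []. Qed.

Lemma string_trw_neq0 (G : graph htype) w : is_string G (trw w) -> w <> [::].
Proof. by move=> /string_neq0; case: w. Qed.

Definition trlab (H : graph htype) : Prop :=
  forall t att, List.In (t, att) (gedges H) -> exists A, t = trR A.

Lemma string_trlab (G : graph htype) w : is_string G (trw w) -> trlab G.
Proof.
move=> hs t att hI.
have : List.In t (map fst (trw w)).
  apply: Permutation.Permutation_in (Perm_sym (is_string_labels hs)) _.
  by apply/In_map; exists (t, att).
by rewrite -map_comp => /In_map[[A d] [/= <- _]]; exists A.
Qed.

Lemma string_at_word (G : graph htype) w E1 A att E2 :
  is_string G (trw w) -> gedges G = E1 ++ (trR A, att) :: E2 ->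
  exists v1 d v2, w = v1 ++ flipd d [:: (A, false)] ++ v2 /\
    string_at G E1 E2 (trw v1) (trR A) d (trw v2).
Proof.
move=> hs /(string_atP hs)[w1 [d [w2 [E hat]]]].
case: (@trw_split w w1 [:: (A, d)] w2 E) => v1 [v2 [-> ? ?]]; subst w1 w2.
by exists v1, d, v2; rewrite flipd1.
Qed.

(** Every label of a premise is a type of the conclusion or a part of one, so [trlab] descends; the
    shapes of translated types then leave only the rule instances that come from L^R. *)
Lemma hl_lr H T : hl_der H T -> trlab H -> forall C, T = trR C ->
  exists w, is_string H (trw w) /\ lr_der (brw w) C.
Proof.
elim=> {H T}.
- move=> p n _ [] //= q [-> ->]; exists [:: (LP q, false)].
  by split; [exact: string_handle | exact: lr_ax].
- move=> H H' A _ IH hi hl C hC.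
  have [|w [hw hd]] := IH _ C hC.
    move=> t att hI; case: hi => _ [f [_ [_ [hp _]]]].
    apply: (hl t (map f att)); apply: Permutation.Permutation_in hp _.
    by apply/In_map; exists (t, att).
  by exists w; split=> //; exact: is_string_giso hi.
- move=> N D H T e att Hs he _ IH hHs IHs hwf D' _ hl C hC.
  have [E1 [E2 [hE he']]] := nth_error_split he; subst e.
  have hR t b : List.In (t, b) (gedges D') -> exists A, t = trR A.
    by move=> h; have [b' /hl] := repl_label hE (or_intror h).
  (* The [$]-edge, which exists by [wf_type], is relabelled [Div N D]; so this type occurs in [D']
     and is a translated one. *)
  have [X hX] : exists X, Div N D = trR X.
    inversion hwf as [|N' D0 _ _ hc _ _|]; subst.
    have [|j [[l att'] [hj]]] := count_nth_error (p := is_dollar) (s := gedges D).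
      by rewrite hc.
    case: l hj => // hj _.
    have [|a' /hR] // := gsubst_label (rep := divL_rep N D Hs)
      (a := iota 0 (size att')) (t := Div N D) hj.
    by left.
  have hD' j t a' t' b' : List.nth_error (gedges D) j = Some (Some t, a') ->
      List.In (t', b') (gedges (Hs j)) -> exists A, t' = trR A.
    by move=> hj hI;
      have [b'' /hR] := @gsubst_label _ _ _ (divL_rep N D Hs) _ _ _ _ _ hj hI.
  have [B hB] : exists B, N = trR B.
    by case: X hX => // [A B|B A] [-> _]; exists B.
  have [|w [hw hwd]] := IH _ C hC.
    move=> t b; rewrite hE In_cat /= => hI.
    case: hI => [hI|[[<- _]|hI]]; last 2 first.
    + by exists B.
    + by have [|b' /hl] // := repl_label (R := D') hE (t := t) (b := b); left;
      apply/In_cat; right.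
    + by have [|b' /hl] // := repl_label (R := D') hE (t := t) (b := b); left;
      apply/In_cat; left.
  subst N; have [v1 [d [v2 [Ew hat]]]] := string_at_word hw hE.
  subst w; case: X hX => // [A B'|B' A] /= [/trR_inj ? ?]; subst B' D.
  + have hn : List.nth_error (gedges (strgraph [:: Some (trR A); None])) 0 =
      Some (Some (trR A), [:: 0; 1]) by [].
    have [|u [hu hud]] := IHs _ _ _ hn _ A erefl; first by move=> t b;
      apply: hD' hn.
    exists (v1 ++ flipd d (u ++ [:: (LDivL A B, false)]) ++ v2); split.
      rewrite !trw_cat trw_flipd; apply: (string_at_repl hat).
      by rewrite trw_cat; apply: string_subst2 => //; exact: string_handle.
    apply: brw_divLL => //; exact: string_trw_neq0 hu.
  + have hn : List.nth_error (gedges (strgraph [:: None; Some (trR A)])) 1 =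
      Some (Some (trR A), [:: 1; 2]) by [].
    have [|u [hu hud]] := IHs _ _ _ hn _ A erefl; first by move=> t b;
      apply: hD' hn.
    exists (v1 ++ flipd d ((LDivR B A, false) :: u) ++ v2); split.
      rewrite !trw_cat trw_flipd; apply: (string_at_repl hat).
      by rewrite -[_ :: u]cat1s trw_cat; apply: string_subst2 => //;
        exact: string_handle.
    apply: brw_divRL => //; exact: string_trw_neq0 hu.
- move=> N D F _ IH [okF [_ [_ hsz]]] hl C hC.
  rewrite hC arity_trR in hsz.
  case: C hC => // [A B|B A] /= [? ?]; subst N D.
  + have [|w [hw hwd]] := IH _ B erefl.
      rewrite gsubst2E => t b /In_cat[[[<- _]|[]]|]; first by exists A.
      by move=> /In_map[[t' b'] [[<- _] /hl]].
    have [u Eu hu] : exists2 u, trw w = (trR A, false) :: u & is_string F u.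
      exact: string_unsubst_r hw.
    have [v1 [v2 [Ew]]] := @trw_split w [::] [:: (A, false)] u Eu.
    case: v1 Ew => // Ew _ Eu'; subst u w; exists v2; split=> //.
    apply: lr_divLR => //; move: (string_trw_neq0 hu); by case: (v2).
  + have [|w [hw hwd]] := IH _ B erefl.
      rewrite gsubst2E => t b /In_cat[|[[<- _]|[]]]; last by exists A.
      by move=> /In_map[[t' b'] [[<- _] /hl]].
    have [u Eu hu] : exists2 u, trw w = rcons u (trR A, false) & is_string F u.
      exact: string_unsubst_l hw.
    rewrite -cats1 in Eu;
      have [v1 [v2 [Ew Eu']]] := @trw_split w u [:: (A, false)] [::] Eu.
    case: v2 Ew => // Ew _; subst u w; exists v1; split=> //.
    rewrite brw_cat in hwd.
    apply: lr_divRR => //; move: (string_trw_neq0 hu); by case: (v1).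
- move=> G e F att T he _ IH [okG [hty _]] hl C hC.
  have [E1 [E2 [hE he']]] := nth_error_split he; subst e.
  have [X hX] := hl _ _ (In_nth_error he).
  have hsz : size att = 2.
    by have [_ <-] := hty _ _ (In_nth_error he); rewrite hX arity_trR.
  have hG12 t b : List.In (t, b) (E1 ++ E2) -> exists A, t = trR A.
    by move=> hI; apply: (hl t b); rewrite hE; move: hI; rewrite !In_cat /=;
      tauto.
  case: X hX => // [A B|A] /= [hF]; subst F.
  + have [|w [hw hwd]] := IH _ C hC.
      move=> t b; rewrite (replE _ hE) /= In_cat /= => hI.
      have : List.In (t, b) (E1 ++ E2) \/ t = trR A \/ t = trR B.
        by rewrite In_cat; case: hI => [|[[<- _]|[[<- _]|]]]; tauto.
      by case=> [/hG12|[|]] //; [exists A | exists B].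
    have [w1 [d [w2 [Ew hs]]]] := string_unprod okG hsz hE hw.
    have [|v1 [v2 [Ew' ? ?]]] := @trw_split w w1 (flipd d [:: (A, false);
      (B, false)]) w2.
      by rewrite trw_flipd.
    subst w w1 w2; exists (v1 ++ flipd d [:: (LProd A B, false)] ++ v2).
    by split; [rewrite flipd1 trw_cat | exact: brw_prodL].
  + case: att hsz hE {he} => [|s [|s' []]] // _ hE.
    have [|w [hw hwd]] := IH _ C hC.
      move=> t b; rewrite (replE _ hE) /= In_cat /= => hI.
      have : List.In (t, b) (E1 ++ E2) \/ t = trR A.
        by rewrite In_cat; case: hI => [|[[<- _]|]]; tauto.
      by case=> [/hG12|] //; exists A.
    have [w1 [d [w2 [Ew hs]]]] := string_unrev hE hw.
    have [v1 [v2 [Ew' ? ?]]] := @trw_split w w1 [:: (A, d)] w2 Ew.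
    subst w w1 w2; exists (v1 ++ (LRev A, ~~ d) :: v2).
    by split; [rewrite trw_cat | exact: brw_revL].
- move=> M Hs _ IHs _ hl C hC.
  have hHs j t a' t' b' : List.nth_error (gedges M) j = Some (t, a') ->
      List.In (t', b') (gedges (Hs j)) -> exists A, t' = trR A.
    by move=> hj hI;
      have [b'' /hl] := @gsubst_label _ _ _ (fun j _ _ => Hs j) _ _ _ _ _ hj hI.
  case: C hC => // [A B|A] /= [?]; subst M.
  + have h0 : List.nth_error (gedges (strgraph [:: trR A; trR B])) 0 =
      Some (trR A, [:: 0; 1]) by [].
    have h1 : List.nth_error (gedges (strgraph [:: trR A; trR B])) 1 =
      Some (trR B, [:: 1; 2]) by [].
    have [|u [hu hud]] := IHs _ _ _ h0 _ A erefl; first by move=> t b;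
      apply: hHs h0.
    have [|v [hv hvd]] := IHs _ _ _ h1 _ B erefl; first by move=> t b;
      apply: hHs h1.
    exists (u ++ v); split; first by rewrite trw_cat; apply: string_subst2.
    rewrite brw_cat; apply: lr_prodR => //.
      by move: (string_trw_neq0 hu); case: (u).
    by move: (string_trw_neq0 hv); case: (v).
  + have h0 : List.nth_error [:: (trR A, [:: 1; 0])] 0 =
      Some (trR A, [:: 1; 0]) by [].
    have [|u [hu hud]] := IHs _ _ _ h0 _ A erefl; first by move=> t b;
      apply: hHs h0.
    exists (flip u); split; last exact: brw_flip.
    by rewrite (trw_flipd true); apply: string_subst_rev.
Qed.

(** * Uniqueness of the word of a string graph, and conclusion *)

Lemma pedges_uniq {L} x s s' (w w' : seq (L * bool)) :
  uniq (x :: s) -> uniq (x :: s') -> size s = size w -> size s' = size w' ->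
  Perm (pedges (x :: s) w) (pedges (x :: s') w') -> w = w'.
Proof.
elim: w x s s' w' => [|a w IH] x [|y s] // s' w' u u' hs hs' hp.
  case: w' s' hs' {u'} hp => [|b w'] [|y' s'] // _.
  by rewrite pedges_cons => /Permutation.Permutation_nil.
case: w' s' hs' u' hp => [|b w'] [|y' s'] //.
  by move=> _ _; rewrite pedges_cons => /Perm_sym/Permutation.Permutation_nil.
move: hs u => [hs] /= /andP[xs us] [hs'] /andP[xs' us'];
  rewrite !pedges_cons => hp.
have out z t (v : seq (L * bool)) : x \notin z :: t ->
    forall e, List.In e (pedges (z :: t) v) -> x \notin e.2.
  by move=> xt e /pedges_sub h; apply/negP => /h; apply/negP.
have inx z (c : L * bool) : x \in (pedge x z c).2.
  by case: c => ? []; rewrite !inE eqxx ?orbT.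
(* The start node [x] lies on the first edge only, so incidence with [x] isolates the first edge of
   both paths. *)
have /= := Perm_filter (fun e : L * seq nat => x \in e.2) hp.
rewrite !inx (filter_none (out _ _ _ xs)) (filter_none (out _ _ _ xs')).
move=> h1; have E := Permutation.Permutation_length_1 h1.
have /= := Perm_filter (fun e : L * seq nat => x \notin e.2) hp.
rewrite !inx /= (filter_every (out _ _ _ xs)) (filter_every (out _ _ _ xs')) => hq.
have xy : x <> y by move=> h; rewrite h mem_head in xs.
have xy' : x <> y' by move=> h; rewrite h mem_head in xs'.
have [? ?] : a = b /\ y = y'.
  move: E; rewrite /pedge; case: (a) (b) => [? []] [? []] /=; split; congruence.
subst b y'; congr cons; exact: IH hq.
Qed.

(** [gext] fixes the end at which reading starts; otherwise [w] and [flip w] could be read off the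
    same path. *)
Lemma string_uniq {L} (G : graph L) w w' :
  is_string G w -> is_string G w' -> w = w'.
Proof.
case=> ns [_ hs hp he hx] [ms [_ hs' hp' he' hx']].
have u : uniq ns by rewrite (perm_uniq hp) iota_uniq.
have u' : uniq ms by rewrite (perm_uniq hp') iota_uniq.
case: ns ms hs hs' hx hx' he he' u u' {hp hp'} => [|x s] [|x' s'] //= [hs] [hs'].
move=> -> [<- _] he he' u u'; apply: pedges_uniq u u' hs hs' _.
exact: Perm_trans he (Perm_sym he').
Qed.

Theorem theorem10 :
  (forall (G : seq ltp) (C : ltp), G <> [::] ->
     (lr_der G C <-> hl_der (trR_seq G C).1 (trR_seq G C).2)) /\
  (forall (H : graph htype) (T : htype),
     hl_der H T ->
     (forall t att, List.In (t, att) (gedges H) -> exists A, t = trR A) ->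
     (exists C0, T = trR C0) ->
     exists (G : seq ltp) (C : ltp),
       G <> [::] /\ in_trR' H T G C /\ lr_der G C).
Proof.
split=> [G C G0|H T hd hl [C hC]].
  have E : strgraph (map trR G) = gstr (trw [seq (A, false) | A <- G]).
    by rewrite /strgraph /trw -!map_comp.
  have hs : is_string (strgraph (map trR G)) (trw [seq (A, false) | A <- G]).
    by rewrite E; apply/gstr_string/trw_nil; case: (G) G0.
  split=> [/lr_hls|/= hd]; first by rewrite /= E.
  have [w [hw hwd]] := hl_lr hd (string_trlab hs) erefl.
  (* The word extracted from the derivation is the all-forward word of [G], whose bracketing is [G]
     itself. *)
  have /trw_inj Ew := string_uniq hw hs.
  by move: hwd; rewrite Ew /brw -map_comp map_id.
have [w [hw hwd]] := hl_lr hd hl hC.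
exists (brw w), C; split; first by case: (w) (string_trw_neq0 hw).
split=> //; split=> //; exists w; split=> //.
by apply: string_giso (hw); apply: gstr_string; exact: string_neq0 hw.
Qed.
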